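(* Let $\Gamma=\Gamma(S_{d_0},HF)$ be a finitely generated saturated directed group acting on $T_{\bar d}$ with $\bar d$ bounded, with step law $\mu$ (below), and let $L_{\Gamma,\mu}(n)=\mathbb{E}\|Y_n\|_\Sigma$ where $Y_n\sim\mu^{*n}$ and $\|\cdot\|_\Sigma$ is the word norm with respect to $\Sigma=S_{d_0}\cup HF$. Let $L_1,L_2:\mathbb N\to(0,\infty)$ satisfy $L_1(n)/L_{\Gamma,\mu}(n)\to\infty$ and $L_2(n)/n\to0$. Then there exist a finitely generated group $\Delta$ with a finite symmetric generating set $\Sigma'$, a surjective homomorphism $\pi:\Delta\to\Gamma$ mapping $\Sigma'$ bijectively onto $\Sigma$, a symmetric probability measure $\mu'$ supported on a finite set with $\pi_*\mu'=\mu$, and a constant $C$, such that, writing $L_{\Delta,\mu'}(n)=\mathbb{E}\|Y'_n\|_{\Sigma'}$ with $Y'_n\sim\mu'^{*n}$: (1) $L_{\Gamma,\mu}(n)\le L_{\Delta,\mu'}(n)\le Cn$ for all $n$; (2) $L_{\Delta,\mu'}(n_i)\le L_1(n_i)$ for an infinite sequence $n_i\to\infty$; (3) $L_{\Delta,\mu'}(m_i)\ge L_2(m_i)$ for an infinite sequence $m_i\to\infty$.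
   Context: $\bar d=(d_j)_{j\ge0}$ is a bounded sequence of integers $d_j\ge2$, $\sigma\bar d=(d_1,d_2,\dots)$. $T_{\bar d}$ is the spherically homogeneous rooted tree with vertices the finite sequences $i_1\dots i_k$, $i_j\in\{1,\dots,d_{j-1}\}$; $\partial T_{\bar d}$ its boundary; $1^\infty=111\dots$. Products of automorphisms follow $(gf)(x)=f(g(x))$. Each $g\in\mathrm{Aut}(T_{\bar d})$ is written $g=(g_1,\dots,g_{d_0})\tau$ ($g_t\in\mathrm{Aut}(T_{\sigma\bar d})$, $\tau\in S_{d_0}$, $g(ty)=\tau(t)g_t(y)$); rooted automorphisms form a copy of $S_{d_0}$. $H_{\bar d}$ is defined recursively: $h\in H_{\bar d}$ iff $h=(h',\sigma_2,\dots,\sigma_{d_0})$ with $h'\in H_{\sigma\bar d}$ and $\sigma_2,\dots,\sigma_{d_0}$ rooted automorphisms of $T_{\sigma\bar d}$; thus $H_{\bar d}\cong\prod_{l\ge1}S_{d_l}^{\,d_{l-1}-1}$. For a finite group $F$, $F\wr_{\partial T_{\bar d}}\mathrm{Aut}(T_{\bar d})=\{\varphi:\partial T_{\bar d}\to F\}\rtimes\mathrm{Aut}(T_{\bar d})$ with $(g.\varphi)(x)=\varphi(g(x))$ and $(\varphi g)(\varphi'g')=\varphi(g.\varphi')gg'$; $\varphi_f$ equals $f$ at $1^\infty$ and is trivial elsewhere. $\Gamma(S_{d_0},HF)$ is the subgroup generated by the rooted group $S_{d_0}$, a finite subgroup $H\le H_{\bar d}$ such that the pushforward of the uniform measure on $H$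 to each factor $S_{d_l}$ is uniform, and $\{\varphi_f:f\in F\}$; $HF\cong H\times F$. $\mu$ is the law of $sks'$ with $s,s'$ uniform on $S_{d_0}$, $k$ uniform on $HF$, independent. *)

(* Defs.v *)
From Stdlib Require Import Reals ClassicalEpsilon.
From HB Require Import structures.
From mathcomp Require Import all_boot all_fingroup.

Set Implicit Arguments. Unset Strict Implicit. Unset Printing Implicit Defensive.

Definition pb (P : Prop) : bool :=
  if excluded_middle_informative P then true else false.

Definition minnat (P : nat -> Prop) : nat :=
  match excluded_middle_informative (exists k, pb (P k)) with
  | left h => @ex_minn (fun k => pb (P k)) h
  | right _ => 0%N
  end.

Definition sumR {A : Type} (l : list A) (f : A -> R) : R :=
  foldr (fun a acc => Rplus (f a) acc) (INR 0) l.

Section Tree.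
(* d j = d_j ; labels {1..d_j} are encoded as 'I_(d j), label 1 <-> 0 *)
Variable d : nat -> nat.

(* boundary points of T_d : infinite paths x_0 x_1 ... *)
Definition bnd := forall j : nat, 'I_(d j).

Definition rootact (s : {perm 'I_(d 0)}) (x : bnd) : bnd :=
  fun j => match j as j0 return 'I_(d j0) with
           | 0 => s (x 0%N)
           | S j' => x (S j')
           end.

(* An element of H_d is encoded by its family of permutations:
   sig j t (for t <> label 1, i.e. val t <> 0) is the rooted automorphism
   sigma_t in S_{d_{j+1}} at the vertex 1^j t.  Its action on the boundary: *)
Definition hact (sig : forall j, 'I_(d j) -> {perm 'I_(d j.+1)}) (x : bnd) : bnd :=
  fun j => match j as j0 return 'I_(d j0) with
           | 0 => x 0%N
           | S j' => if all (fun i => val (x i) == 0%N) (iota 0 j') && (val (x j') != 0%N)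
                     then sig j' (x j') (x j'.+1)
                     else x j'.+1
           end.

Variable F : finGroupType.

(* elements of F wr_{boundary} Aut(T_d): pairs (phi, g) *)
Definition wr := ((bnd -> F) * (bnd -> bnd))%type.

(* (phi g)(phi' g') = phi (g.phi') g g' , with (g.phi')(x) = phi'(g x), (g g')(x) = g'(g x) *)
Definition wmul (a b : wr) : wr :=
  (fun x => (a.1 x * b.1 (a.2 x))%g, fun x => b.2 (a.2 x)).
Definition wone : wr := (fun _ => 1%g, fun x => x).

Definition weq (a b : wr) : Prop :=
  forall x : bnd, a.1 x = b.1 x /\ (forall j, a.2 x j = b.2 x j).

Definition phif (f : F) : bnd -> F :=
  fun x => if pb (forall j, val (x j) = 0%N) then f else 1%g.

Variable K : finGroupType.
Variable rho : K -> forall j, 'I_(d j) -> {perm 'I_(d j.+1)}.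

Inductive gen := GRoot of {perm 'I_(d 0)} | GHF of K & F.

Definition genval (g : gen) : wr :=
  match g with
  | GRoot s => (fun _ => 1%g, rootact s)
  | GHF k f => (phif f, hact (rho k))
  end.

Definition weval (w : list gen) : wr := foldr (fun g acc => wmul (genval g) acc) wone w.

Definition wnormG (w : list gen) : nat :=
  minnat (fun k => exists w' : list gen, size w' = k /\ weq (weval w') (weval w)).

Definition step := ({perm 'I_(d 0)} * (K * F) * {perm 'I_(d 0)})%type.
Definition stepw (st : step) : list gen :=
  [:: GRoot st.1.1; GHF st.1.2.1 st.1.2.2; GRoot st.2].

(* E f(Y_n), Y_n ~ mu^{*n}, mu uniform law of s k s' *)
Fixpoint EG (n : nat) (f : list gen -> R) : R :=
  match n with
  | 0 => f [::]
  | S n' => Rdiv (sumR (enum {: step}) (fun st => EG n' (fun w => f (stepw st ++ w))))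
             (INR #|{: step}|)
  end.

Definition LG (n : nat) : R := EG n (fun w => INR (wnormG w)).

Definition muG (gam : wr) : R :=
  Rdiv (sumR (enum {: step}) (fun st => if pb (weq (weval (stepw st)) gam) then INR 1 else INR 0))
   (INR #|{: step}|).

End Tree.

Record Grp := MkGrp {
  gcar :> Type;
  gmul : gcar -> gcar -> gcar;
  gone : gcar;
  ginv : gcar -> gcar;
  gmulA : forall a b c, gmul a (gmul b c) = gmul (gmul a b) c;
  gmul1 : forall a, gmul gone a = a;
  gmulV : forall a, gmul (ginv a) a = gone
}.

Section GrpDefs.
Variable D : Grp.
Definition gprod (l : list D) : D := foldr (@gmul D) (gone D) l.

Variable A : Type.
Variable iota : A -> D.
Definition dnorm (a : D) : nat :=
  minnat (fun k => exists w : list A, size w = k /\ gprod (map iota w) = a).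

Variable supp : list D.
Variable m : D -> R.
(* E f(Y'_n), Y'_n ~ mu'^{*n}, mu' with finite support supp and weights m *)
Fixpoint ED (n : nat) (f : D -> R) : R :=
  match n with
  | 0 => f (gone D)
  | S n' => sumR supp (fun a => Rmult (m a) (ED n' (fun b => f (gmul a b))))
  end.
Definition LD (n : nat) : R := ED n (fun a => INR (dnorm a)).
End GrpDefs.

(* Main.v *)
(* Delta is a diagonal product of Gamma, of the lamplighter group Z/2 wr D_oo and of finite groups
   G_0, G_1, ..., all marked by the same letters: s0, k0 (an involution of K) and the letter 1 of
   Sigma act as the two reflections and as the lamp, all other letters act trivially.

   A word trivial in Gamma and in the lamplighter has lamps supported in the range of its path, so
   up to constants its norm in their product is at most its norm in Gamma plus that range.  The
   range is diffusive, and so is Gamma at infinitely many times: if f is an eigenfunction with gap g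
   of the walk on a level of the tree, then the displacement of f in L^2 is of order 1 at time 1/g,
   while a letter moves f by O(sqrt g).  Saturation produces such f with g tending to 0, by a
   recursion on the levels.

   The finite group G_i acts on a truncated tree of segments of length 4 kappa_i.  Short words do
   not distinguish it from a quotient of the lamplighter, but the walk drifts away from the root of
   the tree at linear speed.  Being finite, G_0, ..., G_i increase norms by a bounded amount only,
   and G_(i+1), ... are invisible up to a time as large as desired, so the times with a slow and
   with a fast walk can be chosen alternately. *)
Require Import Defs.
From HB Require Import structures.
From mathcomp Require Import all_boot all_fingroup pgroup.
From mathcomp Require Import zify_ssreflect ssrZ.
From Stdlib Require Import Reals ClassicalEpsilon FunctionalExtensionality PropExtensionality ZArith Lra Lia.
Delimit Scope R_scope with R.
Delimit Scope nat_scope with N.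

Set Implicit Arguments. Unset Strict Implicit. Unset Printing Implicit Defensive.

(** * Averages over finite types *)

(** The growth of [L1] is known only relative to [LG], so the diffusive cost of the lamplighter can
    be absorbed only at times when Gamma itself moves at least like sqrt n. This is why a lower
    bound for Gamma along a sequence of times is needed. The dependences fix the order of choices at
    each stage. The size kappa must exceed every word length that mattered before; the fast time m
    depends on the drift for this kappa; the truncation depth 7 m is out of reach of the walk at
    time m; the slow time n depends on the constant of all finite factors chosen so far. No rate in
    kappa is required. The marking is shaped by the conditions on Sigma' and mu'. The letters with a
    nontrivial action are involutions, so that a letter and its inverse act alike. The identity of
    Sigma may become a nontrivial element of Delta, since Sigma' has only to correspond bijectively
    to Sigma; it serves as lamp switch, and mu' can insert it at random without changing the image
    in Gamma. *)

HB.instance Definition _ := Monoid.isComLaw.Build R 0%R Rplus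
  (fun a b c => esym (Rplus_assoc a b c)) Rplus_comm Rplus_0_l.

Local Open Scope R_scope.

Notation "\rsum_ ( i <- r ) F" := (\big[Rplus/0%R]_(i <- r) F%R)
  (at level 41, F at level 41, i, r at level 50) : R_scope.
Notation "\rsum_ i F" := (\big[Rplus/0%R]_i F%R)
  (at level 41, F at level 41, i at level 0) : R_scope.

Lemma sumRE A (l : seq A) (f : A -> R) : sumR l f = \rsum_(a <- l) f a.
Proof. by elim: l => [|a l IH]; rewrite ?big_nil // big_cons /= -/(sumR l f) IH. Qed.

Definition avg (T : finType) (f : T -> R) : R := sumR (enum {: T}) f / INR #|{: T}|.

Lemma avgE (T : finType) (f : T -> R) : avg f = (\rsum_t f t) / INR #|T|.
Proof. by rewrite /avg sumRE big_enum. Qed.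

Lemma rsum_scal I (r : seq I) c (f : I -> R) : \rsum_(i <- r) (c * f i) = c * \rsum_(i <- r) f i.
Proof. by elim: r => [|i r IH]; rewrite ?big_nil ?big_cons ?IH; lra. Qed.

Lemma rsum_le I (r : seq I) (f g : I -> R) : (forall i, f i <= g i) ->
  \rsum_(i <- r) f i <= \rsum_(i <- r) g i.
Proof. by move=> h; elim: r => [|i r IH]; rewrite ?big_nil ?big_cons; [lra | move: (h i); lra]. Qed.

Lemma rsum_const I (r : seq I) c : \rsum_(i <- r) c = INR (size r) * c.
Proof.
elim: r => [|i r IH]; first by rewrite big_nil /=; lra.
rewrite big_cons IH (_ : size (i :: r) = S (size r)) // S_INR /=; ring.
Qed.

Section Avg.
Variable T : finType.
Implicit Types f g : T -> R.

Lemma avg_ext f g : f =1 g -> avg f = avg g.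
Proof. by move=> h; rewrite !avgE; congr (_ / _); apply: eq_bigr. Qed.

Lemma avg_add f g : avg (fun t => f t + g t) = avg f + avg g.
Proof. by rewrite !avgE big_split /Rdiv /= Rmult_plus_distr_r. Qed.

Lemma avg_scal c f : avg (fun t => c * f t) = c * avg f.
Proof. by rewrite !avgE rsum_scal /Rdiv Rmult_assoc. Qed.

Lemma avg_bij f (h : T -> T) : bijective h -> avg (fun t => f (h t)) = avg f.
Proof. by move=> hb; rewrite !avgE; congr (_ / _); rewrite [RHS](reindex h) //; apply: onW_bij. Qed.

Lemma avg_inj f (h : T -> T) : injective h -> avg (fun t => f (h t)) = avg f.
Proof. by move=> /injF_bij; apply: avg_bij. Qed.

Hypothesis T0 : (0 < #|T|)%N.

Lemma card_INR_gt0 : 0 < INR #|T|.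
Proof. by apply: lt_0_INR; apply/ltP. Qed.

Lemma avg_const c : avg (fun _ : T => c) = c.
Proof.
rewrite avgE rsum_const.
have -> : size (index_enum T) = #|T| by rewrite -sum1_card -sum1_size.
by field; apply: Rgt_not_eq; apply: card_INR_gt0.
Qed.

Lemma avg_le f g : (forall t, f t <= g t) -> avg f <= avg g.
Proof.
move=> h; rewrite !avgE; apply: Rmult_le_compat_r; last exact: rsum_le.
by left; apply: Rinv_0_lt_compat; apply: card_INR_gt0.
Qed.

Lemma avg_ge0 f : (forall t, 0 <= f t) -> 0 <= avg f.
Proof. by move=> h; rewrite -(avg_const 0); apply: avg_le. Qed.

Lemma le_card_avg f t : (forall u, 0 <= f u) -> f t <= INR #|T| * avg f.
Proof.
move=> h; rewrite avgE.
have -> : INR #|T| * ((\rsum_u f u) / INR #|T|) = \rsum_u f u.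
  by field; apply: Rgt_not_eq; apply: card_INR_gt0.
rewrite (bigD1 t) //=.
suff: 0 <= \big[Rplus/0]_(i | i != t) f i by lra.
by apply: (big_ind (fun x => 0 <= x)) => // [|x y]; lra.
Qed.

Lemma avg_gt0 f t : (forall u, 0 <= f u) -> 0 < f t -> 0 < avg f.
Proof.
move=> h ht; have := le_card_avg t h; have := card_INR_gt0.
by case: (Rle_lt_dec (avg f) 0) => // h1 h2 h3; nra.
Qed.

End Avg.

Lemma avg_swap (S T : finType) (f : S -> T -> R) :
  avg (fun s => avg (f s)) = avg (fun t => avg (fun s => f s t)).
Proof.
rewrite /avg !sumRE.
under eq_bigr do rewrite sumRE /Rdiv Rmult_comm.
under [in RHS]eq_bigr do rewrite sumRE /Rdiv Rmult_comm.
rewrite !rsum_scal exchange_big /= /Rdiv.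
by rewrite !(Rmult_comm (/ _)) !Rmult_assoc (Rmult_comm (/ INR #|T|)).
Qed.

Lemma avg_pair (S T : finType) (f : S * T -> R) :
  avg f = avg (fun s => avg (fun t => f (s, t))).
Proof.
rewrite !avgE card_prod.
have -> : \rsum_t f t = \rsum_s \rsum_t f (s, t).
  by rewrite pair_big; apply: eq_bigr => -[].
under [in RHS]eq_bigr do rewrite avgE /Rdiv Rmult_comm.
by rewrite rsum_scal -multE mult_INR /Rdiv Rinv_mult; ring.
Qed.

Local Close Scope R_scope.

(** * Words, congruences and the group they define *)

Local Open Scope R_scope.

Section Walk.
Variables (A : Type) (Om : finType) (sw : Om -> seq A).

Fixpoint EW (n : nat) (f : seq A -> R) : R :=
  match n with
  | 0 => f [::]
  | S n' => avg (fun om => EW n' (fun w => f (sw om ++ w)))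
  end.

Lemma EW_ext n f g : f =1 g -> EW n f = EW n g.
Proof.
elim: n f g => [|n IH] f g h /=; first exact: h.
by apply: avg_ext => om; apply: IH => w; apply: h.
Qed.

Lemma EW_add n f g : EW n (fun w => f w + g w) = EW n f + EW n g.
Proof. by elim: n f g => [|n IH] f g //=; rewrite -avg_add; apply: avg_ext => om. Qed.

Lemma EW_scal n c f : EW n (fun w => c * f w) = c * EW n f.
Proof. by elim: n f => [|n IH] f //=; rewrite -avg_scal; apply: avg_ext => om. Qed.

Lemma EW_avg n (T : finType) (f : T -> seq A -> R) :
  EW n (fun w => avg (fun t => f t w)) = avg (fun t => EW n (f t)).
Proof.
elim: n f => [|n IH] f //=; rewrite -avg_swap; apply: avg_ext => om.
exact: (IH (fun t w => f t (sw om ++ w))).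
Qed.

Hypothesis Om0 : (0 < #|Om|)%N.

Lemma EW_const n c : EW n (fun _ => c) = c.
Proof. by elim: n => [|n IH] //=; rewrite -[RHS](avg_const Om0 c); apply: avg_ext. Qed.

Variable l : nat.
Hypothesis sw_size : forall om, (size (sw om) <= l)%N.

(** The comparison is asked only for words that [n] steps can produce. This length bound is what
    later makes truncations and remote finite factors invisible. *)
Lemma EW_le n f g : (forall w, (size w <= l * n)%N -> f w <= g w) -> EW n f <= EW n g.
Proof.
elim: n f g => [|n IH] f g h /=; first exact: h.
apply: avg_le => // om; apply: IH => w hw; apply: h.
by rewrite size_cat mulnS leq_add.
Qed.

End Walk.

Section Congruence.
Variables (A : Type) (inv : A -> A).
Implicit Types (u v w : seq A) (E : seq A -> seq A -> Prop).

(** Every group of the construction is encoded by its word problem over the same letters. A diagonal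
    product of marked groups is then the intersection of their congruences. *)
Record congruence E : Prop := Congruence {
  cong_refl : forall w, E w w;
  cong_sym : forall w v, E w v -> E v w;
  cong_trans : forall w v u, E w v -> E v u -> E w u;
  cong_cat : forall w w' v v', E w w' -> E v v' -> E (w ++ v) (w' ++ v');
  cong_invl : forall a, E [:: inv a; a] [::];
  cong_invr : forall a, E [:: a; inv a] [::] }.

Definition winv w := rev (map inv w).

Lemma size_winv w : size (winv w) = size w.
Proof. by rewrite size_rev size_map. Qed.

Lemma winv_cons a w : winv (a :: w) = winv w ++ [:: inv a].
Proof. by rewrite /winv /= rev_cons cats1. Qed.

Lemma winv_cat w v : winv (w ++ v) = winv v ++ winv w.
Proof. by rewrite /winv map_cat rev_cat. Qed.

Section Theory.
Variable E : seq A -> seq A -> Prop.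
Hypothesis cE : congruence E.

Lemma cong_winvr w : E (w ++ winv w) [::].
Proof.
elim: w => [|a w IH]; first exact: cong_refl.
rewrite winv_cons /= catA -cat1s.
apply: cong_trans (cong_invr cE a) => //.
apply: (cong_cat cE (w' := [:: a])); first exact: cong_refl.
rewrite -[X in E _ X]/([::] ++ [:: inv a]).
by apply: cong_cat => //; apply: cong_refl.
Qed.

Lemma cong_winvl w : E (winv w ++ w) [::].
Proof.
elim: w => [|a w IH]; first exact: cong_refl.
rewrite winv_cons -catA.
apply: cong_trans IH => //.
apply: (cong_cat cE); first exact: cong_refl.
rewrite -[X in E _ X]/([::] ++ w) -[a :: w]cat1s catA.
by apply: cong_cat => //; [exact: (cong_invl cE) | apply: cong_refl].
Qed.

Lemma cong_catr w v v' : E v v' -> E (w ++ v) (w ++ v').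
Proof. by move=> h; apply: cong_cat => //; apply: cong_refl. Qed.

Lemma cong_catl w w' v : E w w' -> E (w ++ v) (w' ++ v).
Proof. by move=> h; apply: cong_cat => //; apply: cong_refl. Qed.

Lemma cong_divr w v : E (w ++ winv v) [::] <-> E w v.
Proof.
split=> h.
- have h1 := cong_catl v h; apply: (cong_trans cE (v := (w ++ winv v) ++ v)) => //.
  rewrite -catA -[X in E X _](cats0 w); apply: cong_catr.
  by apply: cong_sym => //; apply: cong_winvl.
- by apply: (cong_trans cE _ (cong_winvr v)); apply: cong_catl.
Qed.

Lemma cong_winv w v : E w v -> E (winv w) (winv v).
Proof.
move=> h; rewrite -[winv w]cats0.
apply: (cong_trans cE (v := winv w ++ w ++ winv v)).
  apply: cong_catr; apply: cong_sym => //; apply: (cong_trans cE _ (cong_winvr v)).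
  exact: cong_catl.
by rewrite catA -[winv v in X in E _ X]cat0s; apply: cong_catl; apply: cong_winvl.
Qed.

End Theory.

Lemma congruence_and E G : congruence E -> congruence G ->
  congruence (fun w v => E w v /\ G w v).
Proof.
move=> cE cG; split=> [w|w v [h1 h2]|w v u [h1 h2] [h3 h4]|w w' v v' [h1 h2] [h3 h4]|a|a];
  split; solve [ exact: (cong_refl cE) | exact: (cong_refl cG)
               | exact: (cong_sym cE) | exact: (cong_sym cG)
               | exact: (cong_trans cE h1) | exact: (cong_trans cG h2)
               | exact: (cong_cat cE) | exact: (cong_cat cG)
               | exact: (cong_invl cE) | exact: (cong_invl cG)
               | exact: (cong_invr cE) | exact: (cong_invr cG) ].
Qed.

Lemma congruence_forall I (G : I -> seq A -> seq A -> Prop) :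
  (forall i, congruence (G i)) -> congruence (fun w v => forall i, G i w v).
Proof.
move=> cG; split=> [w i|w v h i|w v u h h' i|w w' v v' h h' i|a i|a i].
- exact: (cong_refl (cG i)).
- exact: (cong_sym (cG i)).
- exact: (cong_trans (cG i) (h i)).
- exact: (cong_cat (cG i)).
- exact: (cong_invl (cG i)).
- exact: (cong_invr (cG i)).
Qed.

Definition run X (act : A -> X -> X) w x := foldl (fun y a => act a y) x w.

Lemma run_cat X (act : A -> X -> X) w v x : run act (w ++ v) x = run act v (run act w x).
Proof. exact: foldl_cat. Qed.

(** The invariant [P] restricts to the points on which the letters act invertibly. *)
Lemma congruence_run X (P : X -> Prop) (act : A -> X -> X) :
  (forall a x, P x -> P (act a x)) ->
  (forall a x, P x -> act (inv a) (act a x) = x) ->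
  (forall a x, P x -> act a (act (inv a) x) = x) ->
  congruence (fun w v => forall x, P x -> run act w x = run act v x).
Proof.
move=> hP h1 h2.
have hr w x : P x -> P (run act w x) by elim: w x => [|a w IH] x //= hx; apply/IH/hP.
split=> [//|w v h x hx|w v u h h' x hx|w w' v v' h h' x hx|a x hx|a x hx] /=.
- by rewrite h.
- by rewrite h // h'.
- by rewrite !run_cat h // h' //; apply: hr.
- exact: h2.
- exact: h1.
Qed.

(** The word norm modulo [E]. Since [minnat] is 0 on an empty set, the lemmas below ask for a
    representative. *)
Definition nrm E w := minnat (fun k => exists v, size v = k /\ E v w).

Lemma nrm_le E v w : E v w -> (nrm E w <= size v)%N.
Proof.
move=> h; rewrite /nrm /minnat; case: excluded_middle_informative => // ex.
case: ex_minnP => m _ /(_ (size v)); apply; rewrite /pb.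
by case: excluded_middle_informative => // -[]; exists v.
Qed.

Lemma nrm_ex E v w : E v w -> exists u, size u = nrm E w /\ E u w.
Proof.
move=> h; rewrite /nrm /minnat; case: excluded_middle_informative => [ex|[]].
  by case: ex_minnP => m; rewrite {1}/pb; case: excluded_middle_informative.
exists (size v); rewrite /pb; case: excluded_middle_informative => // -[]; by exists v.
Qed.

Lemma nrm_mono E G w : (forall v u, E v u -> G v u) -> E w w -> (nrm G w <= nrm E w)%N.
Proof. by move=> h /nrm_ex [u [<- hu]]; apply/nrm_le/h. Qed.

End Congruence.

(** * The group of congruence classes and the law of a step on it *)

Section Quotient.
Variables (A : Type) (inv : A -> A) (E : seq A -> seq A -> Prop).
Hypothesis cE : congruence inv E.

(** A class is the predicate [E w] itself; extensionality then turns congruent words into Leibniz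
    equal elements, as [Grp] demands. *)
Definition quot := {P : seq A -> Prop | exists w, P = E w}.

Definition cls (w : seq A) : quot := exist _ (E w) (ex_intro _ w erefl).

Definition rep (a : quot) : seq A := proj1_sig (constructive_indefinite_description _ (proj2_sig a)).

Lemma cls_eq w v : cls w = cls v <-> E w v.
Proof.
split=> [/(congr1 (@proj1_sig _ _)) /= ->|h]; first exact: (cong_refl cE).
have e : E w = E v.
  apply: functional_extensionality => u; apply: propositional_extensionality; split=> h'.
    by apply: (cong_trans cE _ h'); apply: (cong_sym cE).
  exact: (cong_trans cE h).
apply: eq_sig_hprop => // P p q; exact: proof_irrelevance.
Qed.

Lemma repK a : cls (rep a) = a.
Proof.
rewrite /rep; case: constructive_indefinite_description => w /= hw.
apply: eq_sig_hprop => [P p q|]; [exact: proof_irrelevance | exact: esym].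
Qed.

Lemma rep_cls w : E (rep (cls w)) w.
Proof. by apply/cls_eq; rewrite repK. Qed.

Definition qmul a b := cls (rep a ++ rep b).

Lemma qmul_cls w v : qmul (cls w) (cls v) = cls (w ++ v).
Proof. by apply/cls_eq; apply: (cong_cat cE); apply: rep_cls. Qed.

Definition qinv a := cls (winv inv (rep a)).

Lemma qinv_cls w : qinv (cls w) = cls (winv inv w).
Proof. by apply/cls_eq; apply: (cong_winv cE); apply: rep_cls. Qed.

Lemma qmulA a b c : qmul a (qmul b c) = qmul (qmul a b) c.
Proof. by rewrite -(repK a) -(repK b) -(repK c) !qmul_cls catA. Qed.

Lemma qmul1 a : qmul (cls [::]) a = a.
Proof. by rewrite -(repK a) qmul_cls. Qed.

Lemma qmulV a : qmul (qinv a) a = cls [::].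
Proof. by rewrite -(repK a) qinv_cls qmul_cls; apply/cls_eq; apply: (cong_winvl cE). Qed.

Definition quotGrp : Grp := MkGrp qmulA qmul1 qmulV.

Lemma gprod_cls (w : seq A) : @gprod quotGrp (map (fun a => cls [:: a]) w) = cls w.
Proof. by elim: w => [//|a w IH]; rewrite /= -/(gprod _) IH qmul_cls. Qed.

Lemma dnorm_cls w : @dnorm quotGrp A (fun a => cls [:: a]) (cls w) = nrm E w.
Proof.
rewrite /dnorm /nrm; congr minnat; apply: functional_extensionality => k.
apply: propositional_extensionality; split=> -[v [hv h]]; exists v; split=> //.
  by apply/cls_eq; rewrite -h gprod_cls.
by rewrite gprod_cls; apply/cls_eq.
Qed.

Section Step.
Variables (Om : finType) (sw : Om -> seq A).
Hypothesis Om0 : (0 < #|Om|)%N.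

Definition ind (P : Prop) : R := if pb P then INR 1 else INR 0.

Lemma ind_true (P : Prop) : P -> ind P = 1.
Proof. by move=> h; rewrite /ind /pb; case: excluded_middle_informative. Qed.

Lemma ind_false (P : Prop) : ~ P -> ind P = 0.
Proof. by move=> h; rewrite /ind /pb; case: excluded_middle_informative. Qed.

Lemma quot_eq_dec (a b : quot) : {a = b} + {a <> b}.
Proof. exact: excluded_middle_informative. Qed.

Definition qsupp : list quot := List.nodup quot_eq_dec (map (fun om => cls (sw om)) (enum {: Om})).

Definition qm (a : quot) : R := avg (fun om => ind (cls (sw om) = a)).

Lemma qm_ge0 a : 0 <= qm a.
Proof. by apply: avg_ge0 => // om; rewrite /ind; case: pb => /=; lra. Qed.

Lemma in_qsupp om : List.In (cls (sw om)) qsupp.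
Proof.
apply/List.nodup_In/List.in_map_iff; exists om; split=> //.
have : om \in enum {: Om} by rewrite mem_enum.
by elim: (enum _) => //= x s IH; rewrite in_cons => /orP[/eqP->|/IH]; [left | right].
Qed.

Lemma qm_notin a : ~ List.In a qsupp -> qm a = 0.
Proof.
move=> h; rewrite /qm -(avg_const Om0 0); apply: avg_ext => om; apply: ind_false => e.
by apply: h; rewrite -e; apply: in_qsupp.
Qed.

Lemma rsum_ind (l : list quot) a (g : quot -> R) : List.NoDup l -> List.In a l ->
  \rsum_(b <- l) (ind (a = b) * g b) = g a.
Proof.
elim: l => [//|b l IH] /List.NoDup_cons_iff [hb hl] /=; rewrite big_cons => -[e|h].
  rewrite -e in hb *; rewrite ind_true //.
  suff -> : \rsum_(c <- l) (ind (b = c) * g c) = 0 by lra.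
  elim: l {IH hl e} hb => [|c l IH] hb; first by rewrite big_nil.
  rewrite big_cons IH; last by move=> h; apply: hb; right.
  by rewrite ind_false; [lra | move=> e; apply: hb; left].
by rewrite IH // ind_false; [lra | move=> e; apply: hb; rewrite -e].
Qed.

(** The support lists each class once, with the total weight of the outcomes that fall into it, so
    summing over classes amounts to averaging over outcomes. *)
Lemma rsum_qm (g : quot -> R) : \rsum_(a <- qsupp) (qm a * g a) = avg (fun om => g (cls (sw om))).
Proof.
transitivity (avg (fun om => \rsum_(a <- qsupp) (ind (cls (sw om) = a) * g a))).
  rewrite avgE exchange_big /= /Rdiv Rmult_comm -rsum_scal; apply: eq_bigr => a _.
  rewrite /qm avgE /Rdiv (Rmult_comm _ (/ _)) Rmult_assoc; congr (_ * _).
  by rewrite Rmult_comm -rsum_scal; apply: eq_bigr => om _; rewrite Rmult_comm.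
apply: avg_ext => om; apply: rsum_ind; [exact: List.NoDup_nodup | exact: in_qsupp].
Qed.

Lemma ED_cls n f : @ED quotGrp qsupp qm n f = EW sw n (fun w => f (cls w)).
Proof.
elim: n f => [//|n IH] f /=; rewrite sumRE.
rewrite (rsum_qm (fun a => ED (D := quotGrp) qsupp qm n (fun b => f (qmul a b)))).
apply: avg_ext => om; rewrite IH; apply: EW_ext => w; by rewrite qmul_cls.
Qed.

Lemma LD_cls n : @LD quotGrp A (fun a => cls [:: a]) qsupp qm n = EW sw n (fun w => INR (nrm E w)).
Proof. by rewrite /LD ED_cls; apply: EW_ext => w; rewrite dnorm_cls. Qed.

(** A bijection of the outcomes that inverts steps exchanges the fibres over a class and over its
    inverse. *)
Lemma qm_inv (h : Om -> Om) : bijective h -> (forall om, E (sw (h om)) (winv inv (sw om))) ->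
  forall a, qm (qinv a) = qm a.
Proof.
move=> hb hs a; rewrite /qm -[LHS](avg_bij _ hb); apply: avg_ext => om.
have -> : cls (sw (h om)) = qinv (cls (sw om)) by rewrite qinv_cls; apply/cls_eq.
have hVV b : qinv (qinv b) = b.
  rewrite -(repK b) !qinv_cls; apply/cls_eq.
  exact/(cong_divr cE)/(cong_winvl cE).
congr (if pb _ then _ else _); apply: propositional_extensionality.
by split=> [/(congr1 qinv)|->//]; rewrite !hVV.
Qed.

End Step.
End Quotient.

Local Close Scope R_scope.

(** * The directed group *)

Section Directed.
Variables (d : nat -> nat) (F : finGroupType).
Implicit Types x y : bnd d.

Lemma bnd_ext x y : (forall j, x j = y j) -> x = y.
Proof. exact: functional_extensionality_dep. Qed.

Lemma weqE (a b : wr d F) : weq a b <-> a = b.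
Proof.
split=> [h|-> //]; case: a b h => [a1 a2] [b1 b2] h.
congr pair; apply: functional_extensionality => x; first by have [] := h x.
by apply: bnd_ext => j; have [_ hj] := h x; apply: hj.
Qed.

(** A directed element changes at most the coordinate following the first nonzero one. Hence it
    preserves [firstnz], and directed elements compose coordinate by coordinate. *)
Definition firstnz x j := all (fun i => val (x i) == 0%N) (iota 0 j) && (val (x j) != 0%N).

Lemma firstnzP x j :
  reflect ((forall i, (i < j)%N -> val (x i) = 0%N) /\ val (x j) <> 0%N) (firstnz x j).
Proof.
apply: (iffP andP) => -[h1 /eqP h2]; split=> //.
  by move=> i hi; apply/eqP; apply: (allP h1); rewrite mem_iota.
by apply/allP => i; rewrite mem_iota /= => /h1 ->.
Qed.

Implicit Type sig : forall j, 'I_(d j) -> {perm 'I_(d j.+1)}.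

Lemma hact_zeros sig x j : (forall i, (i < j)%N -> val (x i) = 0%N) ->
  forall i, (i <= j)%N -> hact sig x i = x i.
Proof.
move=> h [|i] hi //=; rewrite -/(firstnz x i).
by case: firstnzP => // -[_ []]; apply: h.
Qed.

Lemma hact_zerosE sig x j :
  (forall i, (i < j)%N -> val (hact sig x i) = 0%N) <-> (forall i, (i < j)%N -> val (x i) = 0%N).
Proof.
split=> h i hi; last by rewrite (hact_zeros _ h) ?h // ltnW.
elim: j h i hi => [//|j IH] h i hi.
have h' : forall i, (i < j)%N -> val (x i) = 0%N.
  by apply: IH => i0 h0; apply/h/(leq_trans h0).
by rewrite -(hact_zeros sig h') // h.
Qed.

Lemma hact_firstnz sig x j : firstnz (hact sig x) j = firstnz x j.
Proof.
apply/firstnzP/firstnzP => -[h1 h2].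
  by have h := (hact_zerosE sig x j).1 h1; split=> //; rewrite -(hact_zeros sig h).
by split; [exact/hact_zerosE | rewrite (hact_zeros sig h1)].
Qed.

Lemma hact_at sig x j : firstnz x j -> hact sig x j = x j.
Proof. by move=> /firstnzP [h _]; apply: hact_zeros h _ _. Qed.

Lemma hactS sig x j : hact sig x j.+1 = if firstnz x j then sig j (x j) (x j.+1) else x j.+1.
Proof. by []. Qed.

Definition zeroend x := pb (forall j, val (x j) = 0%N).

Lemma pb_iff (P Q : Prop) : (P <-> Q) -> pb P = pb Q.
Proof.
rewrite /pb => -[h1 h2]; case: excluded_middle_informative => hP; case: excluded_middle_informative => hQ //.
  by case: hQ; apply: h1.
by case: hP; apply: h2.
Qed.

Lemma hact_zeroend sig x : zeroend (hact sig x) = zeroend x.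
Proof.
apply: pb_iff; split=> h j.
  by apply: ((hact_zerosE sig x j.+1).1) (ltnSn j) => i _.
by apply: ((hact_zerosE sig x j.+1).2) (ltnSn j) => i _.
Qed.

Lemma phif_zeroend f x : phif f x = (if zeroend x then f else 1%g : F).
Proof. by []. Qed.

Lemma wmulA (a b c : wr d F) : wmul a (wmul b c) = wmul (wmul a b) c.
Proof. by rewrite /wmul /=; congr pair; apply: functional_extensionality => x; rewrite mulgA. Qed.

Lemma wmul1 (a : wr d F) : wmul (wone d F) a = a.
Proof.
by case: a => a1 a2; rewrite /wmul /=; congr pair; apply: functional_extensionality => x; rewrite mul1g.
Qed.

Lemma wmulr1 (a : wr d F) : wmul a (wone d F) = a.
Proof.
by case: a => a1 a2; rewrite /wmul /=; congr pair; apply: functional_extensionality => x; rewrite mulg1.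
Qed.

Variables (K : finGroupType) (rho : K -> forall j, 'I_(d j) -> {perm 'I_(d j.+1)}).
Arguments rho : clear implicits.

Local Notation weval := (@weval d F K rho).
Local Notation genval := (@genval d F K rho).

Lemma weval_cat w v : weval (w ++ v) = wmul (weval w) (weval v).
Proof.
elim: w => [|a w IH] /=; first by rewrite wmul1.
by rewrite -!/(weval _) IH wmulA.
Qed.

Lemma weval1 a : weval [:: a] = genval a.
Proof. exact: wmulr1. Qed.

Hypothesis rho_hom : forall (k1 k2 : K) j (t : 'I_(d j)), val t <> 0%N ->
  rho (k1 * k2)%g j t = (rho k1 j t * rho k2 j t)%g.

Lemma rho1 j (t : 'I_(d j)) : val t <> 0%N -> rho 1%g j t = 1%g.
Proof.
move=> ht; have := rho_hom 1%g 1%g ht; rewrite mulg1 => h.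
by apply: (mulgI (rho 1%g j t)); rewrite -h mulg1.
Qed.

Lemma hact_mul k1 k2 x : hact (rho k2) (hact (rho k1) x) = hact (rho (k1 * k2)%g) x.
Proof.
apply: bnd_ext => -[//|j]; rewrite !hactS hact_firstnz.
case h: (firstnz x j) => //; rewrite hact_at // rho_hom ?permM //.
by case/firstnzP: h.
Qed.

Lemma hact_one x : hact (rho 1%g) x = x.
Proof.
apply: bnd_ext => -[//|j]; rewrite hactS; case: firstnzP => // -[_ h].
by rewrite rho1 // perm1.
Qed.

Lemma rootact_mul (s1 s2 : {perm 'I_(d 0)}) x : rootact s2 (rootact s1 x) = rootact (s1 * s2)%g x.
Proof. by apply: bnd_ext => -[|j] //=; rewrite permM. Qed.

Lemma rootact_one x : rootact 1%g x = x.
Proof. by apply: bnd_ext => -[|j] //=; rewrite perm1. Qed.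

Lemma genval_root1 : genval (GRoot _ _ 1%g) = wone d F.
Proof. by apply/weqE => x; rewrite /= rootact_one. Qed.

Lemma genval_HF1 : genval (GHF d 1%g 1%g) = wone d F.
Proof. by apply/weqE => x; rewrite /= hact_one phif_zeroend; case: ifP. Qed.

Lemma genval_rootM s1 s2 :
  wmul (genval (GRoot _ _ s1)) (genval (GRoot _ _ s2)) = genval (GRoot _ _ (s1 * s2)%g).
Proof. by apply/weqE => x; rewrite /= rootact_mul mulg1. Qed.

Lemma genval_HFM k1 f1 k2 f2 :
  wmul (genval (GHF d k1 f1)) (genval (GHF d k2 f2)) = genval (GHF d (k1 * k2)%g (f1 * f2)%g).
Proof.
apply/weqE => x; rewrite /= hact_mul !phif_zeroend hact_zeroend.
by case: ifP; rewrite ?mulg1.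
Qed.

Definition letinv (a : gen d F K) : gen d F K :=
  match a with GRoot s => GRoot F K s^-1%g | GHF k f => GHF d k^-1%g f^-1%g end.

Lemma letinvK : involutive letinv.
Proof. by case=> [s|k f] /=; rewrite !invgK. Qed.

Lemma wevalV a : wmul (genval a) (genval (letinv a)) = wone d F.
Proof.
by case: a => [s|k f]; rewrite ?genval_rootM ?genval_HFM !mulgV ?genval_root1 ?genval_HF1.
Qed.

Lemma congruence_weval : congruence letinv (fun w v => weval w = weval v).
Proof.
split=> [//|//|w v u -> //|w w' v v' h h'|a|a].
- by rewrite !weval_cat h h'.
- by rewrite -[[:: _; _]]/([:: letinv a] ++ [:: a]) weval_cat !weval1 -{2}(letinvK a) wevalV.
- by rewrite -[[:: _; _]]/([:: a] ++ [:: letinv a]) weval_cat !weval1 wevalV.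
Qed.

Hypothesis hd2 : forall j, (2 <= d j)%N.
Hypothesis rho_inj : forall k1 k2 : K,
  (forall j (t : 'I_(d j)), val t <> 0%N -> rho k1 j t = rho k2 j t) -> k1 = k2.

Lemma d_gt0 j : (0 < d j)%N.
Proof. exact: ltnW (hd2 j). Qed.

Definition x0 : bnd d := fun j => Ordinal (d_gt0 j).

Definition setx x j (p : 'I_(d j)) : bnd d := fun i =>
  match PeanoNat.Nat.eq_dec j i with left e => eq_rect j (fun j => 'I_(d j)) p i e | right _ => x i end.

Lemma setx_same x j p : setx x p j = p :> 'I_(d j).
Proof.
rewrite /setx; case: PeanoNat.Nat.eq_dec => // e.
by rewrite (Eqdep_dec.UIP_dec PeanoNat.Nat.eq_dec e erefl).
Qed.

Lemma setx_other x j (p : 'I_(d j)) i : i <> j -> setx x p i = x i.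
Proof. by move=> h; rewrite /setx; case: PeanoNat.Nat.eq_dec => // e; case: h. Qed.

Lemma genval_root_inj s1 s2 : genval (GRoot _ _ s1) = genval (GRoot _ _ s2) -> s1 = s2.
Proof.
move=> /weqE h; apply/permP => t.
have [_ /(_ 0%N)] := h (setx x0 t).
by rewrite /= setx_same.
Qed.

Lemma genval_HF_inj k1 f1 k2 f2 :
  genval (GHF d k1 f1) = genval (GHF d k2 f2) -> k1 = k2 /\ f1 = f2.
Proof.
move=> /weqE h; split; last first.
  have [/= + _] := h x0; rewrite !phif_zeroend.
  suff -> : zeroend x0 by [].
  by rewrite /zeroend /pb; case: excluded_middle_informative => // -[].
apply: rho_inj => j t ht; apply/permP => p.
have [_ /(_ j.+1)] := h (setx (setx x0 t) p).
rewrite [X in X = _ -> _]hactS [X in _ = X -> _]hactS.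
have hj : setx (setx x0 t) p j = t.
  by rewrite setx_other ?setx_same // => /eqP; rewrite ltn_eqF.
have -> : firstnz (setx (setx x0 t) p) j.
  apply/firstnzP; rewrite hj; split=> // i hi.
  by rewrite !setx_other //; lia.
by rewrite hj setx_same.
Qed.

(** Directed elements fix the first coordinate of every path, so only the identity has both a rooted
    and a directed name. *)
Lemma genval_root_HF s k f : genval (GRoot _ _ s) = genval (GHF d k f) ->
  [/\ s = 1%g, k = 1%g & f = 1%g].
Proof.
move=> h.
have hs : s = 1%g.
  apply/permP => t; rewrite perm1; move/weqE: h => /(_ (setx x0 t)) [_ /(_ 0%N)] /=.
  by rewrite setx_same.
move: h; rewrite hs genval_root1 -genval_HF1 => /genval_HF_inj [<- <-]; split=> //.
Qed.

End Directed.

(** * Functions of finitely many levels *)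

Local Open Scope R_scope.

Section Shift.
Variable d : nat -> nat.

Definition sh : nat -> nat := fun j => d j.+1.

Definition consx (t : 'I_(d 0)) (x : bnd sh) : bnd d :=
  fun j => match j as j0 return 'I_(d j0) with 0 => t | S j' => x j' end.

Definition tlx (x : bnd d) : bnd sh := fun j => x j.+1.

Lemma consx_tlx x : consx (x 0%N) (tlx x) = x.
Proof. by apply: bnd_ext => -[|j]. Qed.

Lemma rootact_cons s t x : rootact s (consx t x) = consx (s t) x.
Proof. by apply: bnd_ext => -[|j]. Qed.

Variable sig : forall j, 'I_(d j) -> {perm 'I_(d j.+1)}.

Lemma firstnz_cons t x j : firstnz (consx t x) j.+1 = (val t == 0%N) && firstnz x j.
Proof.
by rewrite /firstnz /= -[1%N]/(1 + 0)%N iotaDl all_map -andbA.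
Qed.

Lemma hact_cons0 t x : val t = 0%N ->
  hact sig (consx t x) = consx t (hact (d := sh) (fun j => sig (j := j.+1)) x).
Proof.
move=> ht; apply: bnd_ext => -[//|j].
have -> : consx t (hact (d := sh) (fun j => sig (j := j.+1)) x) j.+1 =
  hact (d := sh) (fun j => sig (j := j.+1)) x j by [].
rewrite hactS; case: j => [|j]; first by rewrite /firstnz /= ht.
by rewrite firstnz_cons ht eqxx hactS.
Qed.

Lemma hact_consN t x : val t <> 0%N -> hact sig (consx t x) = consx t (rootact (sig t) x).
Proof.
move=> /eqP ht; apply: bnd_ext => -[//|[|j]]; rewrite hactS.
  by rewrite /firstnz /= ht.
by rewrite firstnz_cons (negbTE ht).
Qed.

End Shift.

(** Dependence on the first [l] coordinates, by recursion along the tree so as to follow the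
    recursive structure of directed elements. *)
Fixpoint dep (l : nat) : forall d, (bnd d -> R) -> Prop :=
  match l with
  | 0 => fun d f => forall x y, f x = f y
  | S l' => fun d f => forall t, dep l' (fun x => f (consx t x))
  end.

(** The integral over the uniform measure on the first [l] levels; [x] supplies the coordinates
    below them. *)
Fixpoint integ (l : nat) : forall d, bnd d -> (bnd d -> R) -> R :=
  match l with
  | 0 => fun d x f => f x
  | S l' => fun d x f => avg (fun t => integ l' (tlx x) (fun y => f (consx t y)))
  end.

Section Integ.
Implicit Types (l : nat) (d : nat -> nat).

Lemma dep_op (op : R -> R -> R) l d (f g : bnd d -> R) :
  dep l f -> dep l g -> dep l (fun x => op (f x) (g x)).
Proof.
elim: l d f g => [|l IH] d f g /= hf hg; first by move=> x y; rewrite (hf x y) (hg x y).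
by move=> t; apply: IH.
Qed.

Lemma dep_rootact l d (f : bnd d -> R) s : dep l f -> dep l (fun x => f (rootact s x)).
Proof.
case: l => [|l] /= h; first by move=> x y; apply: h.
by move=> t; exact: (h (s t)).
Qed.

Lemma dep_hact l d (f : bnd d -> R) sig : dep l f -> dep l (fun x => f (hact sig x)).
Proof.
elim: l d f sig => [|l IH] d f sig /= h; first by move=> x y; apply: h.
move=> t; case: (eqVneq (val t) 0%N) => [|/eqP] ht.
  have := IH _ _ (fun j => sig j.+1) (h t); congr dep; apply: functional_extensionality => x.
  by rewrite hact_cons0.
have := dep_rootact (sig 0%N t) (h t); congr dep; apply: functional_extensionality => x.
by rewrite hact_consN.
Qed.

Lemma integ_ext l d (x : bnd d) f g : f =1 g -> integ l x f = integ l x g.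
Proof.
elim: l d x f g => [|l IH] d x f g h /=; first exact: h.
by apply: avg_ext => t; apply: IH => y; apply: h.
Qed.

Lemma integ_add l d (x : bnd d) f g : integ l x (fun y => f y + g y) = integ l x f + integ l x g.
Proof.
elim: l d x f g => [//|l IH] d x f g /=; rewrite -avg_add; apply: avg_ext => t.
exact: (IH _ _ (fun y => f (consx t y)) (fun y => g (consx t y))).
Qed.

Lemma integ_scal l d (x : bnd d) c f : integ l x (fun y => c * f y) = c * integ l x f.
Proof.
elim: l d x f => [//|l IH] d x f /=; rewrite -avg_scal; apply: avg_ext => t.
exact: (IH _ _ (fun y => f (consx t y))).
Qed.

Lemma integ_avg l d (x : bnd d) (T : finType) (f : T -> bnd d -> R) :
  integ l x (fun y => avg (fun t => f t y)) = avg (fun t => integ l x (f t)).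
Proof.
elim: l d x f => [//|l IH] d x f /=; rewrite -avg_swap; apply: avg_ext => u.
exact: (IH _ _ (fun t y => f t (consx u y))).
Qed.

Lemma integ_EW l d (x : bnd d) A (Om : finType) (sw : Om -> seq A) n (f : seq A -> bnd d -> R) :
  integ l x (fun y => EW sw n (fun w => f w y)) = EW sw n (fun w => integ l x (f w)).
Proof.
elim: l d x f => [//|l IH] d x f /=; rewrite EW_avg; apply: avg_ext => u.
exact: (IH _ _ (fun w y => f w (consx u y))).
Qed.

Lemma integ_rootact l d (x : bnd d) f s :
  dep l f -> integ l x (fun y => f (rootact s y)) = integ l x f.
Proof.
case: l => [|l] /= h; first exact: h.
rewrite -(avg_inj (fun t => integ l (tlx x) (fun y => f (consx t y))) (@perm_inj _ s)).
by apply: avg_ext => t; apply: integ_ext => y; rewrite rootact_cons.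
Qed.

(** The first coordinate is fixed, and on the subtree below it the element is either directed again
    or a rooted permutation; both preserve the uniform measure. *)
Lemma integ_hact l d (x : bnd d) f sig :
  dep l f -> integ l x (fun y => f (hact sig y)) = integ l x f.
Proof.
elim: l d x f sig => [|l IH] d x f sig /= h; first exact: h.
apply: avg_ext => t; case: (eqVneq (val t) 0%N) => [|/eqP] ht.
  rewrite -(IH _ (tlx x) _ (fun j => sig j.+1) (h t)); apply: integ_ext => y.
  by rewrite hact_cons0.
rewrite -(integ_rootact (tlx x) (sig 0%N t) (h t)); apply: integ_ext => y.
by rewrite hact_consN.
Qed.

Section Positive.
Variable d : nat -> nat.
Hypothesis d0 : forall j, (0 < d j)%N.

Lemma integ_le l (x : bnd d) f g : (forall y, f y <= g y) -> integ l x f <= integ l x g.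
Proof.
elim: l d d0 x f g => [|l IH] e e0 x f g h /=; first exact: h.
by apply: avg_le; [rewrite card_ord|move=> t; apply: (IH _ (fun j => e0 j.+1))].
Qed.

Lemma integ_ge0 l (x : bnd d) f : (forall y, 0 <= f y) -> 0 <= integ l x f.
Proof.
move=> h; have -> : 0 = integ l x (fun=> 0 * 0) by rewrite integ_scal; ring.
by apply: integ_le => y; rewrite Rmult_0_l.
Qed.

End Positive.

Lemma integ_gt0 l d (d0 : forall j, (0 < d j)%N) (x y : bnd d) f :
  dep l f -> (forall y, 0 <= f y) -> 0 < f y -> 0 < integ l x f.
Proof.
elim: l d d0 x y f => [|l IH] d d0 x y f hd h0 hy /=; first by rewrite (hd x y).
apply: (@avg_gt0 _ _ _ (y 0%N)); first by rewrite card_ord.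
  by move=> t; apply: (integ_ge0 (fun j => d0 j.+1)) => z.
apply: (IH _ (fun j => d0 j.+1) _ (tlx y)) => //.
by rewrite consx_tlx.
Qed.

End Integ.

Lemma avg_perm n (t : 'I_n) (f : 'I_n -> R) : avg (fun s : {perm 'I_n} => f (s t)) = avg f.
Proof.
have n0 : (0 < #|'I_n|)%N by apply/card_gt0P; exists t.
have S0 : (0 < #|{perm 'I_n}|)%N by apply/card_gt0P; exists 1%g.
have h u : avg (fun s : {perm 'I_n} => f (s u)) = avg (fun s : {perm 'I_n} => f (s t)).
  rewrite -(avg_inj (fun s : {perm 'I_n} => f (s u)) (mulgI (tperm t u))).
  by apply: avg_ext => s; rewrite permM tpermR.
transitivity (avg (fun u => avg (fun s : {perm 'I_n} => f (s u)))).
  by rewrite -[LHS](avg_const n0); apply: avg_ext.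
rewrite avg_swap -[RHS](avg_const S0); apply: avg_ext => s.
exact: (avg_inj f (@perm_inj _ s)).
Qed.

(** All fibres have equal size, so the uniform measure is pushed forward to the uniform one; this is
    the form in which saturation is used. *)
Lemma avg_fibre (S T : finType) (h : S -> T) (f : T -> R) : (0 < #|T|)%N -> (0 < #|S|)%N ->
  (forall t, (#|[set s | h s == t]| * #|T| = #|S|)%N) -> avg (fun s => f (h s)) = avg f.
Proof.
move=> T0 S0 hh; rewrite !avgE.
have hT := card_INR_gt0 T0; have hS := card_INR_gt0 S0.
apply: (Rmult_eq_reg_r (INR #|S|)); last lra.
have -> : (\rsum_s f (h s)) / INR #|S| * INR #|S| = \rsum_s f (h s) by field; lra.
rewrite (partition_big h xpredT) //=.
have -> : (\rsum_t f t) / INR #|T| * INR #|S| = \rsum_t ((INR #|S| / INR #|T|) * f t).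
  by rewrite rsum_scal; field; lra.
apply: eq_bigr => t _.
rewrite -(hh t) -multE mult_INR.
have -> : forall a, a * INR #|T| / INR #|T| = a by move=> a; field; lra.
rewrite -big_filter.
have -> : #|[set s | h s == t]| = size [seq s <- index_enum S | h s == t].
  by rewrite cardsE -sum1_card -sum1_size -big_filter.
elim: (index_enum S) => [|s r IH] /=; first by rewrite big_nil; exact: (esym (Rmult_0_l _)).
case: eqP => [e|_] //; rewrite big_cons IH e -[size (_ :: _)]/((size [seq x <- r | h x == t]).+1) S_INR; ring.
Qed.

Local Close Scope R_scope.

(** * Eigenfunctions with small spectral gap *)

Local Open Scope R_scope.

Section Averages.
Variables (d : nat -> nat) (K : finGroupType) (rho : K -> forall j, 'I_(d j) -> {perm 'I_(d j.+1)}).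

Definition Aop (f : bnd d -> R) x := avg (fun s => f (rootact s x)).
Definition Kop (f : bnd d -> R) x := avg (fun k => f (hact (rho k) x)).

Record saturated : Prop := Saturated {
  sat_ge2 : forall j, (2 <= d j)%N;
  sat_hom : forall (k1 k2 : K) j (t : 'I_(d j)), val t <> 0%N ->
    rho (k1 * k2)%g t = (rho k1 t * rho k2 t)%g;
  sat_unif : forall j (t : 'I_(d j)), val t <> 0%N -> forall p : {perm 'I_(d j.+1)},
    (#|[set k : K | rho k t == p]| * #|{: {perm 'I_(d j.+1)}}| = #|K|)%N }.

Record eigen (L : nat) (f : bnd d -> R) (lam : R) : Prop := Eigen {
  eig_dep : dep L f;
  eig_inv : forall s x, f (rootact s x) = f x;
  eig_eq : forall x, Aop (Kop f) x = lam * f x;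
  eig_nz : exists x, f x <> 0 }.

End Averages.

Lemma group_card_gt0 (G : finGroupType) : (0 < #|G|)%N.
Proof. by apply/card_gt0P; exists 1%g. Qed.

Lemma saturated_sh d (K : finGroupType) (rho : K -> forall j, 'I_(d j) -> {perm 'I_(d j.+1)}) :
  saturated rho -> saturated (d := sh d) (fun k j => rho k j.+1).
Proof.
by case=> h1 h2 h3; split; [move=> j; apply: h1 | move=> k1 k2 j; apply: h2 | move=> j; apply: h3].
Qed.

Lemma avg_zero_ord n (a b : R) : (0 < n)%N ->
  avg (fun u : 'I_n => if val u == 0%N then a else b) = / INR n * a + (1 - / INR n) * b.
Proof.
move=> n0; have hn : 0 < INR n by apply: lt_0_INR; apply/ltP.
transitivity (avg (fun u : 'I_n => b + (a - b) * (if val u == 0%N then 1 else 0))).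
  by apply: avg_ext => u; case: eqP => _; ring.
rewrite avg_add avg_const ?card_ord // avg_scal avgE card_ord.
rewrite (bigD1 (Ordinal n0)) //= big1; first by field; lra.
by move=> u; rewrite -val_eqE /= => /negbTE ->.
Qed.

(** * From an eigenfunction on the subtree to one on the tree *)

Section Recursion.
Variables (d : nat -> nat) (K : finGroupType) (rho : K -> forall j, 'I_(d j) -> {perm 'I_(d j.+1)}).
Hypothesis sat : saturated rho.
Let d' := sh d.
Let rho' : K -> forall j, 'I_(d' j) -> {perm 'I_(d' j.+1)} := fun k j => rho k (j := j.+1).
Let p := / INR (d 0).

Lemma Kop_tlx (G : bnd d' -> R) t x :
  Kop rho (fun y => G (tlx y)) (consx t x) = if val t == 0%N then Kop rho' G x else Aop G x.
Proof.
case: eqP => ht.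
  by apply: avg_ext => k; rewrite hact_cons0.
rewrite /Kop /Aop -(avg_fibre (h := fun k => rho k t) (fun s => G (rootact s x))).
- by apply: avg_ext => k; rewrite hact_consN.
- exact: group_card_gt0.
- exact: group_card_gt0.
- exact: sat_unif sat _ _ ht.
Qed.

(** After a uniform rooted permutation the first label is 1 with probability [p]. Below it a
    directed element acts on the subtree as a directed element; below any other label it acts, by
    saturation, as a uniform rooted permutation. *)
Lemma AKop_tlx (G : bnd d' -> R) x :
  Aop (Kop rho (fun y => G (tlx y))) x = p * Kop rho' G (tlx x) + (1 - p) * Aop G (tlx x).
Proof.
rewrite -{1}(consx_tlx x) -avg_zero_ord; last exact: ltnW (sat_ge2 sat 0).
rewrite -(avg_perm (x 0%N)); apply: avg_ext => s.
by rewrite rootact_cons Kop_tlx.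
Qed.

Lemma p_bounds : 0 < p <= / 2.
Proof.
have h : 2 <= INR (d 0) by rewrite -[2]/(INR 2); apply: le_INR; apply/leP/(sat_ge2 sat).
split; first by apply: Rinv_0_lt_compat; lra.
by apply: Rinv_le_contravar; lra.
Qed.

(** The span of [f] and [Kop rho' f] is invariant under [p * Kop + (1 - p) * Aop] on the subtree,
    because [Aop] fixes [f] and sends [Kop rho' f] to [lam' * f], and [Kop] is idempotent. The
    quadratic equation is the characteristic polynomial of this two by two matrix, and the function
    in the conclusion is the eigenvector for [lam]. *)
Lemma eigen_rec L f lam lam' : eigen rho' L f lam' ->
  p < lam -> 0 < lam' -> lam * lam - lam + p * (1 - p) * (1 - lam') = 0 ->
  eigen rho L.+1 (fun x => (lam - p) * f (tlx x) + p * Kop rho' f (tlx x)) lam.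
Proof.
move=> [hd hi he [z hz]] hp hl hq.
have [p0 p1] := p_bounds.
pose G y := (lam - p) * f y + p * Kop rho' f y.
have hA x : Aop G x = (lam - p + p * lam') * f x.
  rewrite /Aop avg_add !avg_scal (_ : avg (fun t => f (rootact t x)) = f x); last first.
    by rewrite -[RHS](avg_const (group_card_gt0 {perm 'I_(d' 0)})); apply: avg_ext => s.
  by have := he x; rewrite /Aop => ->; ring.
have sat' := saturated_sh sat.
have hK x : Kop rho' G x = lam * Kop rho' f x.
  rewrite {1}/Kop avg_add !avg_scal -/(Kop rho' f x).
  suff -> : avg (fun t => Kop rho' f (hact (rho' t) x)) = Kop rho' f x by ring.
  rewrite -[RHS](avg_const (group_card_gt0 K)); apply: avg_ext => k.
  rewrite /Kop -(avg_inj (fun k => f (hact (rho' k) x)) (mulgI k)).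
  by apply: avg_ext => k'; rewrite hact_mul //; apply: sat_hom sat'.
split.
- move=> t; apply: (@dep_op (fun a b => (lam - p) * a + p * b)) => //.
  have h k : dep L (fun x => f (hact (rho' k) x)) by apply: dep_hact.
  rewrite /tlx /= /Kop /avg.
  have : forall r : seq K, dep L (fun x => sumR r (fun k => f (hact (rho' k) x)) / INR #|K|).
    move=> r; apply: (@dep_op (fun a _ => a / INR #|K|) _ _ _ f) => //.
    elim: r => [|k r IH] /=; last exact: (dep_op Rplus (h k) IH).
    by elim: (L) (d') => [|l IH] e.
  exact.
- by move=> s x; rewrite -(consx_tlx x) rootact_cons.
- move=> x; rewrite (AKop_tlx G) hA hK.
  suff -> : (1 - p) * ((lam - p + p * lam') * f (tlx x)) = lam * ((lam - p) * f (tlx x)) by ring.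
  rewrite -!Rmult_assoc; congr (_ * _); lra.
(* If [G] vanished, so would [Aop G], which is [f] times [lam - p + p * lam'], a positive number. *)
- case: (classic (exists y, G y <> 0)) => [[y hy]|h].
    by exists (consx (x0 (sat_ge2 sat) 0%N) y).
  have hG y : G y = 0 by apply: NNPP => hy; apply: h; exists y.
  have : Aop G z = 0.
    by rewrite -(avg_const (group_card_gt0 {perm 'I_(d' 0)}) 0); apply: avg_ext.
  rewrite hA => /Rmult_integral [|//]; have := Rmult_lt_0_compat _ _ p0 hl; lra.
Qed.

(** A mean zero function of the second coordinate is fixed by directed elements of the subtree and
    averaged to 0 by its rooted permutations, so only the weight [p] survives. *)
Lemma eigen_base : exists f, eigen rho 2 f p.
Proof.
have h1 : (1 < d' 0)%N := sat_ge2 sat 1.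
pose psi (u : 'I_(d' 0)) : R := if val u == 0%N then 1 else if val u == 1%N then -1 else 0.
pose G (y : bnd d') := psi (y 0%N).
have hpsi : avg psi = 0.
  rewrite avgE (bigD1 (Ordinal (ltnW h1))) //= (bigD1 (Ordinal h1)) //= big1.
    by rewrite /psi /=; field; have := card_INR_gt0 (T := 'I_(d' 0)); rewrite card_ord => /(_ (ltnW h1)); lra.
  by move=> u; rewrite -!val_eqE /= /psi => /andP[/negbTE -> /negbTE ->].
exists (fun x => G (tlx x)); split.
- by move=> t u x y.
- by move=> s x; rewrite -(consx_tlx x) rootact_cons.
- move=> x; rewrite AKop_tlx.
  have -> : Kop rho' G (tlx x) = G (tlx x).
    by rewrite -[RHS](avg_const (group_card_gt0 K)); apply: avg_ext => k.
  have -> : Aop G (tlx x) = 0 by rewrite /Aop (avg_perm (tlx x 0%N)).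
  ring.
- exists (x0 (sat_ge2 sat)); rewrite /G /psi /=; lra.
Qed.

End Recursion.

(** With [y = 4 p (1 - p) (1 - lam')] the larger root of the characteristic equation is
    [(1 + sqrt (1 - y)) / 2]. Its gap is at most [y / 2], hence at most half of the gap [1 - lam'].
    The induction runs over all trees at once, since each step passes to the shifted sequence. *)
Lemma eigen_small_gap (l : nat) d (K : finGroupType)
    (rho : K -> forall j, 'I_(d j) -> {perm 'I_(d j.+1)}) : saturated rho ->
  exists L f lam, [/\ eigen rho L f lam, 0 < lam < 1 & 1 - lam <= (/ 2) ^ l].
Proof.
elim: l d rho => [|l IH] d rho sat; have [p0 p1] := p_bounds sat.
  have [f hf] := eigen_base sat; exists 2%N, f, (/ INR (d 0%N)); split=> //; move=> /=; lra.
have [L [f [lam' [hf [l0 l1] hl]]]] := IH _ _ (saturated_sh sat).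
set p := / INR (d 0%N) in p0 p1.
pose y := 4 * p * (1 - p) * (1 - lam').
have hp4 : 0 < 4 * p * (1 - p) <= 1 by have := Rle_0_sqr (2 * p - 1); rewrite /Rsqr; nra.
have y0 : 0 < y by apply: Rmult_lt_0_compat; lra.
have y1 : y <= 1 - lam' by rewrite /y; nra.
have hy : p * (1 - p) * (1 - lam') = y / 4 by rewrite /y; field.
clearbody y.
have hs := sqrt_sqrt (1 - y); have hs0 := sqrt_lt_R0 (1 - y).
have hs1 : sqrt (1 - y) < 1 by rewrite -[X in _ < X]sqrt_1; apply: sqrt_lt_1; lra.
have hs2 : 1 - y <= sqrt (1 - y) by nra.
exists L.+1, (fun x => ((1 + sqrt (1 - y)) / 2 - p) * f (tlx x)
  + p * Kop (d := sh d) (fun k j => rho k j.+1) f (tlx x)), ((1 + sqrt (1 - y)) / 2); split.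
- apply: (eigen_rec sat hf); rewrite // -/p; first by lra.
  rewrite hy.
  have := hs; nra.
- lra.
- rewrite /=; lra.
Qed.

Local Close Scope R_scope.

(** * A diffusive lower bound for the directed group *)

Local Open Scope R_scope.

Lemma INR_lt_pow2 n : INR n < 2 ^ n.
Proof.
elim: n => [|n IH]; first by rewrite /=; lra.
rewrite S_INR /=; have : 1 <= 2 ^ n by apply: pow_R1_Rle; lra.
lra.
Qed.

Section LowerBound.
Variables (d : nat -> nat) (F K : finGroupType).
Variable rho : K -> forall j, 'I_(d j) -> {perm 'I_(d j.+1)}.
Hypothesis sat : saturated rho.

Local Notation weval := (@weval d F K rho).
Local Notation genval := (@genval d F K rho).
Local Notation G := (gen d F K).

Definition eqG (w v : seq G) : Prop := weval w = weval v.

Lemma wnormGE w : wnormG rho w = nrm eqG w.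
Proof.
rewrite /wnormG /nrm; congr minnat; apply: functional_extensionality => k.
by apply: propositional_extensionality; split=> -[v [hv h]]; exists v; split=> //; apply/weqE.
Qed.

Lemma EG_EW n (f : seq G -> R) : EG n f = EW (@stepw d F K) n f.
Proof. by elim: n f => [//|n IH] f /=; apply: avg_ext => st; rewrite IH. Qed.

Section WithEigen.
Variables (L : nat) (f : bnd d -> R) (lam : R).
Hypothesis ef : eigen rho L f lam.

Let hx0 : bnd d := x0 (sat_ge2 sat).
Let I := integ L hx0.
Let hd : dep L f := eig_dep ef.
Let d0 j : (0 < d j)%N := d_gt0 (sat_ge2 sat) j.

Definition moved (w : seq G) x := f ((weval w).2 x).

Lemma moved_cons a w x : moved (a :: w) x = moved w ((genval a).2 x).
Proof. by []. Qed.

Lemma dep_genval g a : dep L g -> dep L (fun x => g ((genval a).2 x)).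
Proof. by move=> hg; case: a => [s|k e] /=; [apply: dep_rootact | apply: dep_hact]. Qed.

Lemma dep_moved w : dep L (moved w).
Proof. by elim: w => [|a w IH]; [exact: hd | exact: (dep_genval a IH)]. Qed.

Lemma integ_genval g a : dep L g -> I (fun x => g ((genval a).2 x)) = I g.
Proof. by move=> hg; case: a => [s|k e] /=; [apply: integ_rootact | apply: integ_hact]. Qed.

Lemma integ_moved (h : R -> R) w : I (fun x => h (moved w x)) = I (fun x => h (f x)).
Proof.
elim: w => [//|a w <-].
rewrite -(integ_genval a (g := fun x => h (moved w x))) //.
by apply: (@dep_op (fun a _ => h a) L d (moved w) (moved w)); apply: dep_moved.
Qed.

(** The closing permutation of a step is absorbed by the rooted invariance of [f], so one step acts
    on [f] as [Aop (Kop f)]. *)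
Lemma EW_moved n x : EW (@stepw d F K) n (fun w => moved w x) = lam ^ n * f x.
Proof.
elim: n x => [|n IH] x /=; first by rewrite Rmult_1_l.
transitivity (avg (fun st : step d F K =>
    lam ^ n * f (rootact st.2 (hact (rho st.1.2.1) (rootact st.1.1 x))))).
  by apply: avg_ext => -[[s [k e]] s'] /=; rewrite -IH.
rewrite avg_scal avg_pair avg_pair (Rmult_comm lam) Rmult_assoc; congr (_ * _).
rewrite -(eig_eq ef x) /Aop; apply: avg_ext => s.
rewrite avg_pair /Kop; apply: avg_ext => k /=.
rewrite -[RHS](avg_const (group_card_gt0 F)); apply: avg_ext => e.
rewrite -[RHS](avg_const (group_card_gt0 {perm 'I_(d 0)})); apply: avg_ext => s'.
exact: (eig_inv ef).
Qed.

Definition energy := I (fun x => f x * f x).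
Definition disp w := I (fun x => (moved w x - f x) * (moved w x - f x)).

Lemma energy_gt0 : 0 < energy.
Proof.
have [x hx] := eig_nz ef.
apply: (@integ_gt0 _ _ d0 _ x); first exact: (dep_op Rmult hd hd).
  by move=> y; apply: Rle_0_sqr.
exact: Rsqr_pos_lt.
Qed.

Lemma dispE w : disp w = 2 * energy + (-2) * I (fun x => moved w x * f x).
Proof.
have -> : 2 * energy = I (fun x => moved w x * moved w x) + energy.
  by rewrite (integ_moved (fun a => a * a)) /energy; ring.
rewrite /energy /disp /I -!integ_scal -!integ_add; apply: integ_ext => x; ring.
Qed.

Lemma disp_ge0 w : 0 <= disp w.
Proof. by apply: integ_ge0 => // y; apply: Rle_0_sqr. Qed.

Lemma disp_le4 w : disp w <= 4 * energy.
Proof.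
have : disp w + I (fun x => (moved w x + f x) * (moved w x + f x)) = 4 * energy.
  have -> : 4 * energy = 2 * I (fun x => moved w x * moved w x) + 2 * energy.
    by rewrite (integ_moved (fun a => a * a)) /energy; ring.
  rewrite /energy /disp /I -!integ_scal -!integ_add; apply: integ_ext => x; ring.
have : 0 <= I (fun x => (moved w x + f x) * (moved w x + f x)).
  by apply: integ_ge0 => // y; apply: Rle_0_sqr.
lra.
Qed.

Lemma EW_disp n : EW (@stepw d F K) n disp = 2 * (1 - lam ^ n) * energy.
Proof.
have S0 : (0 < #|{: step d F K}|)%N by apply/card_gt0P; exists (1%g, (1%g, 1%g), 1%g).
rewrite (EW_ext _ _ dispE) EW_add (EW_const _ S0) EW_scal /I -integ_EW.
have -> : integ L hx0 (fun y => EW (@stepw d F K) n (fun w => moved w y * f y)) = lam ^ n * energy.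
  rewrite /energy /I -integ_scal; apply: integ_ext => x.
  rewrite -Rmult_assoc -EW_moved Rmult_comm -EW_scal; apply: EW_ext => w; ring.
ring.
Qed.

Let M := 2 * INR #|K| * (1 - lam) * energy.

(** Rooted invariance gives the same inner product with [f] to [Kop f] and to [Aop (Kop f)], namely
    [lam * energy]. So the average of [disp] over directed letters is [2 (1 - lam) energy], and one
    letter is at most [#|K|] times the average. *)
Lemma disp_genval a : disp [:: a] <= M.
Proof.
have hE k e : disp [:: GHF d k e] =
    I (fun x => (f (hact (rho k) x) - f x) * (f (hact (rho k) x) - f x)) by [].
have M_avg : M = INR #|K| * avg (fun k => disp [:: GHF d k 1%g]).
  rewrite /M (avg_ext (fun k => dispE [:: GHF d k 1%g])) avg_add.
  rewrite (avg_const (group_card_gt0 K)) avg_scal -integ_avg -/I.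
  have -> : I (fun y => avg (fun k => moved [:: GHF d k 1%g] y * f y)) =
      I (fun y => f y * Kop rho f y).
    by apply: integ_ext => y; rewrite -avg_scal; apply: avg_ext => k; rewrite Rmult_comm.
  have dK : dep L (fun y => f y * Kop rho f y).
    apply: (dep_op Rmult) => //; rewrite /Kop /avg.
    apply: (@dep_op (fun a _ => a / INR #|K|) _ _ _ f) => //.
    elim: (enum _) => [|k r IH] /=; last exact: (dep_op Rplus (dep_hact _ hd) IH).
    exact: (@dep_op (fun _ _ => 0) _ _ f f).
  have -> : I (fun y => f y * Kop rho f y) = lam * energy.
    transitivity (I (fun y => avg (fun s => f (rootact s y) * Kop rho f (rootact s y)))).
      rewrite /I integ_avg -[LHS](avg_const (group_card_gt0 {perm 'I_(d 0)})).
      by apply: avg_ext => s; rewrite (integ_rootact hx0 s dK).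
    rewrite /energy /I -integ_scal; apply: integ_ext => y.
    rewrite -Rmult_assoc -(eig_eq ef) Rmult_comm -avg_scal; apply: avg_ext => s.
    by rewrite (eig_inv ef).
  ring.
case: a => [s|k e].
  have -> : disp [:: GRoot F K s] = I (fun x => 0 * 0).
    by apply: integ_ext => x; rewrite moved_cons /moved /= (eig_inv ef); ring.
  rewrite /I integ_scal Rmult_0_l M_avg.
  apply: Rmult_le_pos; first exact: pos_INR.
  by apply: avg_ge0; [exact: group_card_gt0 | move=> k; apply: disp_ge0].
rewrite M_avg; rewrite hE -(hE _ 1%g).
by apply: (le_card_avg (group_card_gt0 K) (f := fun k => disp [:: GHF d k 1%g])) => u; apply: disp_ge0.
Qed.

Lemma M_ge0 : 0 <= M.
Proof. exact: Rle_trans (disp_ge0 _) (disp_genval (GRoot _ _ 1%g)). Qed.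

(* Minkowski's inequality is replaced by (a + b)^2 <= (1 + 1/r) a^2 + (1 + r) b^2. *)
Lemma disp_le_size w : disp w <= INR (size w) * INR (size w) * M.
Proof.
have M0 := M_ge0.
elim: w => [|a w IH].
  have -> : disp [::] = I (fun x => 0 * 0).
    by apply: integ_ext => x; rewrite /moved /=; ring.
  by rewrite /I integ_scal /=; lra.
have h1 : I (fun x => (moved (a :: w) x - moved [:: a] x) * (moved (a :: w) x - moved [:: a] x)) = disp w.
  rewrite /disp -(integ_genval a (g := fun x => (moved w x - f x) * (moved w x - f x))) //.
  by apply: (@dep_op (fun u v => (u - v) * (u - v))) => //; apply: dep_moved.
case: w IH h1 => [|b w] IH h1; first by rewrite /=; have := disp_genval a; lra.
rewrite -[size (a :: _)]/((size (b :: w)).+1) S_INR.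
have r0 : 0 < INR (size (b :: w)) by apply: lt_0_INR; apply/ltP.
set r := INR (size (b :: w)) in IH r0 *.
have h2 : disp (a :: b :: w) <= (1 + / r) * disp (b :: w) + (1 + r) * disp [:: a].
  rewrite -h1 /disp /I -!integ_scal -integ_add; apply: integ_le => // x.
  set u := moved (a :: b :: w) x; set v := moved [:: a] x.
  have := Rle_0_sqr ((u - v) - r * (v - f x)); rewrite /Rsqr => h.
  have h' : 0 <= / r * ((u - v - r * (v - f x)) * (u - v - r * (v - f x))).
    by apply: Rmult_le_pos => //; left; apply: Rinv_0_lt_compat.
  have e : / r * ((u - v - r * (v - f x)) * (u - v - r * (v - f x))) =
      / r * ((u - v) * (u - v)) - 2 * (u - v) * (v - f x) + r * ((v - f x) * (v - f x)).
    by field; lra.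
  rewrite e in h'; nra.
apply: (Rle_trans _ _ _ h2).
apply: (Rle_trans _ ((1 + / r) * (r * r * M) + (1 + r) * M)); last first.
  by right; field; lra.
apply: Rplus_le_compat; apply: Rmult_le_compat_l => //; try lra.
  by have := Rinv_0_lt_compat _ r0; lra.
exact: disp_genval.
Qed.

Lemma disp_le_norm w : disp w <= INR (wnormG rho w) * INR (wnormG rho w) * M.
Proof.
have [v [<- hv]] : exists v, size v = wnormG rho w /\ eqG v w.
  by rewrite wnormGE; apply: (@nrm_ex _ _ w).
have -> : disp w = disp v by rewrite /disp /moved hv.
exact: disp_le_size.
Qed.

End WithEigen.

(** At a time [n] close to the inverse gap the mean displacement is at least the energy [e], while a
    word of norm [r] displaces by at most a multiple of [e * r^2 / n]. The trivial bound [4 e] turns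
    this into a bound linear in [r], so that the first moment of the norm suffices. *)
Lemma LG_diffusive : exists c, 0 < c /\
  forall N, exists n, (N <= n)%N /\ (0 < n)%N /\ c * sqrt (INR n) <= @LG d F K rho n.
Proof.
have k0 : 0 < INR #|K| by apply: card_INR_gt0; apply: group_card_gt0.
have sk : 0 < sqrt (INR #|K|) by apply: sqrt_lt_R0.
exists (/ (4 * sqrt (INR #|K|))); split; first by apply: Rinv_0_lt_compat; lra.
move=> N.
have [L [f [lam [ef [l0 l1] hl]]]] := eigen_small_gap N sat.
set g := 1 - lam in hl.
have g0 : 0 < g by rewrite /g; lra.
have [hn1 hn2] := archimed (/ g).
have ig0 := Rinv_0_lt_compat _ g0.
set n := Z.to_nat (up (/ g)).
have hz : (0 <= up (/ g))%Z by apply: le_IZR; lra.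
have hn : INR n = IZR (up (/ g)) by rewrite /n INR_IZR_INZ Z2Nat.id.
have hig : 2 ^ N <= / g.
  rewrite -[2 ^ N]Rinv_inv; apply: Rinv_le_contravar => //.
  by rewrite -pow_inv.
have hNn : INR N < INR n.
  rewrite hn; have := INR_lt_pow2 N.
  lra.
have hNn' : (N < n)%N by apply/ltP/INR_lt.
exists n; split; [exact: ltnW | split; first exact: leq_ltn_trans hNn'].
have n1 : 1 <= INR n by rewrite -[1]/(INR 1); apply: le_INR; apply/leP; exact: leq_ltn_trans hNn'.
have sn : 0 < sqrt (INR n) by apply: sqrt_lt_R0; lra.
have hgn : 1 <= g * INR n.
  by rewrite -(Rinv_r g); [apply: Rmult_le_compat_l; lra | lra].
have hgn2 : g * INR n <= 2.
  have : INR n <= 2 * / g.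
    have : 1 <= / g by rewrite -[1]Rinv_1; apply: Rinv_le_contravar => //; rewrite /g; lra.
    by lra.
  move=> /(Rmult_le_compat_l g _ _ (Rlt_le _ _ g0)).
  by rewrite (_ : g * (2 * / g) = 2); [|field; lra].
(* Bernoulli's inequality gives [(1 + g)^n >= 2], and [(1 + g) * lam <= 1]. *)
have hpow : lam ^ n <= / 2.
  have h1 : (1 + g) ^ n * lam ^ n <= 1.
    rewrite -Rpow_mult_distr -[X in _ <= X](pow1 n); apply: pow_incr; rewrite /g; nra.
  have h2 := poly n g g0; have h3 := pow_le lam n (Rlt_le _ _ l0).
  nra.
have e0 := energy_gt0 ef; set e := energy L f in e0.
have hD : e <= EW (@stepw d F K) n (disp L f).
  by rewrite (EW_disp ef) -/e; nra.
have S0 : (0 < #|{: step d F K}|)%N by apply/card_gt0P; exists (1%g, (1%g, 1%g), 1%g).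
(* From [D <= 4 e] and [D <= e t^2] follows [D <= 2 e t], by the first bound when [t > 2] and by the
   second otherwise. *)
have hw w : disp L f w <= (4 * sqrt (INR #|K|) * e / sqrt (INR n)) * INR (wnormG rho w).
  have := disp_le_norm ef w; have := disp_le4 ef w; rewrite -/e.
  set r := INR (wnormG rho w); set D := disp _ _ _ => hD4 hDr.
  pose t := 2 * sqrt (INR #|K|) * r / sqrt (INR n).
  have r0 : 0 <= r by apply: pos_INR.
  have t0 : 0 <= t.
    by apply: Rmult_le_pos; [nra | left; apply: Rinv_0_lt_compat].
  have ht : t * t = 4 * INR #|K| * (r * r) / INR n.
    have e1 : sqrt (INR n) * sqrt (INR n) = INR n by apply: sqrt_sqrt; lra.
    have e2 : sqrt (INR #|K|) * sqrt (INR #|K|) = INR #|K| by apply: sqrt_sqrt; lra.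
    by rewrite -[in RHS]e1 -[in RHS]e2 /t; field; lra.
  have -> : 4 * sqrt (INR #|K|) * e / sqrt (INR n) * r = e * (2 * t) by rewrite /t; field; lra.
  have hDt : D <= e * (t * t).
    apply: (Rle_trans _ _ _ hDr); rewrite ht.
    have -> : e * (4 * INR #|K| * (r * r) / INR n) = (2 * INR #|K| * (r * r) * e) * (2 / INR n).
      by field; lra.
    have -> : r * r * (2 * INR #|K| * g * e) = (2 * INR #|K| * (r * r) * e) * g by ring.
    apply: Rmult_le_compat_l; first by apply: Rmult_le_pos; [have := Rle_0_sqr r; rewrite /Rsqr; nra | lra].
    apply: (Rmult_le_reg_r (INR n)); first lra.
    by rewrite /Rdiv Rmult_assoc Rinv_l; lra.
  case: (Rle_lt_dec t 2) => h2; last nra.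
  by apply: (Rle_trans _ _ _ hDt); apply: Rmult_le_compat_l; nra.
have : EW (@stepw d F K) n (disp L f) <=
    EW (@stepw d F K) n (fun w => 4 * sqrt (INR #|K|) * e / sqrt (INR n) * INR (wnormG rho w)).
  by apply: (EW_le S0 (l := 3)).
rewrite EW_scal /LG EG_EW; set E := EW _ _ (fun w => INR _) => hE.
have : e <= 4 * sqrt (INR #|K|) * e / sqrt (INR n) * E by exact: (Rle_trans _ _ _ hD hE).
have -> : 4 * sqrt (INR #|K|) * e / sqrt (INR n) * E = e * (4 * sqrt (INR #|K|) * E / sqrt (INR n)).
  by field; lra.
rewrite -{1}(Rmult_1_r e) => /(Rmult_le_reg_l _ _ _ e0) h.
apply: (Rmult_le_reg_l (4 * sqrt (INR #|K|))); first lra.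
rewrite -Rmult_assoc Rinv_r; last lra.
rewrite Rmult_1_l; move: h => /(Rmult_le_compat_r _ _ _ (Rlt_le _ _ sn)).
by rewrite Rmult_1_l /Rdiv !Rmult_assoc Rinv_l ?Rmult_1_r -?Rmult_assoc //; lra.
Qed.

End LowerBound.

Local Close Scope R_scope.

(** * The lamplighter group over the infinite dihedral group *)

Inductive lamp := Neutral | Al | Be | Ep.

(** The Cayley graph of the infinite dihedral group is a line. Cell [i] has the halves [(i, false)]
    and [(i, true)], exchanged by [Al]; the letter [Be] exchanges [(i, true)] and
    [(i + 1, false)]. *)
Definition site := (Z * bool)%type.

Definition mv (a : lamp) (x : site) : site :=
  match a with
  | Al => (x.1, ~~ x.2)
  | Be => if x.2 then ((x.1 + 1)%Z, false) else ((x.1 - 1)%Z, true)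
  | _ => x
  end.

Definition toggles (a : lamp) (x z : site) : bool := if a is Ep then x == z else false.

Fixpoint par (z x : site) (w : seq lamp) : bool :=
  if w is a :: w' then toggles a x z (+) par z (mv a x) w' else false.

(** Quantifying over all starting points makes compatibility with concatenation immediate; by
    [eqL_base] the start at [base] already decides. *)
Definition eqL (w v : seq lamp) : Prop :=
  forall x, run mv w x = run mv v x /\ forall z, par z x w = par z x v.

Fixpoint far (x : site) (w : seq lamp) : Z :=
  if w is a :: w' then Z.max (Z.abs x.1) (far (mv a x) w') else Z.abs x.1.

Definition base : site := (0%Z, false).

Lemma mvK a : involutive (mv a).
Proof. by case: a => //= -[i []] //=; congr pair; lia. Qed.

Lemma par_cat z x w v : par z x (w ++ v) = par z x w (+) par z (run mv w x) v.
Proof. by elim: w x => [//|a w IH] x /=; rewrite IH addbA. Qed.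

Lemma congruence_eqL : congruence (@id lamp) eqL.
Proof.
have hpair a : eqL [:: a; a] [::].
  move=> x /=; rewrite mvK; split=> // z.
  by case: a => //=; rewrite addbF addbb.
split=> [//|w v h x|w v u h h' x|w w' v v' h h' x|//|//].
- by have [-> h2] := h x; split=> // z; rewrite h2.
- by have [-> h2] := h x; have [-> h3] := h' x; split=> // z; rewrite h2 h3.
- have [h1 h2] := h x; have [h3 h4] := h' (run mv w' x); rewrite !run_cat h1 h3; split=> // z.
  by rewrite !par_cat h2 h1 h4.
Qed.

Lemma congruence_map A B (inv : A -> A) (binv : B -> B) (f : A -> B) E :
  congruence binv E -> (forall a, f (inv a) = binv (f a)) ->
  congruence inv (fun w v => E (map f w) (map f v)).
Proof.
move=> cE hf; split=> [w|w v|w v u|w w' v v' h h'|a|a] /=; rewrite ?map_cat ?hf.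
- exact: (cong_refl cE).
- exact: (cong_sym cE).
- exact: (cong_trans cE).
- exact: (cong_cat cE).
- exact: (cong_invl cE).
- exact: (cong_invr cE).
Qed.

(* The label-preserving automorphism of the line carrying [base] to [x]. *)
Definition shift (x z : site) : site :=
  (if x.2 then (x.1 - z.1)%Z else (x.1 + z.1)%Z, x.2 (+) z.2).

Lemma shift_mv x a z : shift x (mv a z) = mv a (shift x z).
Proof. by case: a x z => -[i []] [j []] //=; rewrite /shift /=; congr pair; lia. Qed.

Lemma shift_run x w z : shift x (run mv w z) = run mv w (shift x z).
Proof. by elim: w z => [//|a w IH] z /=; rewrite -/(run _ _ _) IH shift_mv. Qed.

Lemma shift_inj x : injective (shift x).
Proof.
by case: x => i [] [j []] [k []] //= [] h; congr pair; lia.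
Qed.

Lemma shift_base x : shift x base = x.
Proof. by case: x => i []; rewrite /shift /=; congr pair; lia. Qed.

Lemma shift_surj x z : exists y, shift x y = z.
Proof.
exists (if x.2 then (x.1 - z.1)%Z else (z.1 - x.1)%Z, x.2 (+) z.2).
by case: x z => i [] [j []]; rewrite /shift /=; congr pair; lia.
Qed.

Lemma par_shift x z y w : par (shift x z) (shift x y) w = par z y w.
Proof.
elim: w y => [//|a w IH] y /=; rewrite -shift_mv IH; congr addb.
by case: a => //; rewrite /toggles (eqtype.inj_eq (@shift_inj x)).
Qed.

Lemma eqL_base w v : run mv w base = run mv v base -> (forall z, par z base w = par z base v) ->
  eqL w v.
Proof.
move=> h1 h2 x; rewrite -(shift_base x) -!shift_run h1; split=> // z.
by have [y <-] := shift_surj x z; rewrite !par_shift h2.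
Qed.

Lemma far_start x w : (Z.abs x.1 <= far x w)%Z.
Proof. by case: w => [|a w] /=; lia. Qed.
Arguments far_start : clear implicits.

Lemma far_end x w : (Z.abs (run mv w x).1 <= far x w)%Z.
Proof. by elim: w x => [|a w IH] x /=; [lia | have := @IH (mv a x); rewrite /run; lia]. Qed.
Arguments far_end : clear implicits.

Lemma far_cat x w v : far x (w ++ v) = Z.max (far x w) (far (run mv w x) v).
Proof.
elim: w x => [|a w IH] x /=; first by have := far_start x v; lia.
by rewrite IH -/(run _ _ _); lia.
Qed.

Lemma par_far z x w : par z x w -> (Z.abs z.1 <= far x w)%Z.
Proof.
elim: w x => [//|a w IH] x /=; case h: (par z _ w); first by have := @IH _ h; lia.
by rewrite addbF; case: a {h} => //= /eqP <-; lia.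
Qed.

Lemma mv_abs a x : (Z.abs (mv a x).1 <= Z.abs x.1 + 1)%Z.
Proof. by case: a x => -[i []] /=; lia. Qed.
Arguments mv_abs : clear implicits.

Lemma far_size x w : (far x w <= Z.abs x.1 + Z.of_nat (size w))%Z.
Proof.
elim: w x => [|a w IH] x; first by rewrite /=; lia.
rewrite -[size (a :: w)]/((size w).+1) Nat2Z.inj_succ /=.
have := @IH (mv a x); have := mv_abs a x; lia.
Qed.
Arguments far_size : clear implicits.

(* Words that backtrack along the line except for the letters [Ep]. *)
Inductive excursion : seq lamp -> Prop :=
| Exc_nil : excursion [::]
| Exc_ep w : excursion w -> excursion (Ep :: w)
| Exc_al u w : excursion u -> excursion w -> excursion (Al :: u ++ Al :: w)
| Exc_be u w : excursion u -> excursion w -> excursion (Be :: u ++ Be :: w).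

Lemma excursion_cat u w : excursion u -> excursion w -> excursion (u ++ w).
Proof.
move=> hu hw; elim: hu => [//|v _ IH|v t hv _ _ IH|v t hv _ _ IH] /=.
- exact: Exc_ep.
- by rewrite -catA /=; apply: Exc_al.
- by rewrite -catA /=; apply: Exc_be.
Qed.

Lemma excursion_run w x : excursion w -> run mv w x = x.
Proof.
move=> h; elim: h x => [//|v _ IH|v t _ IHv _ IHt|v t _ IHv _ IHt] x.
- exact: IH.
- by rewrite -cat1s run_cat run_cat IHv -cat1s run_cat IHt; apply: (mvK Al).
- by rewrite -cat1s run_cat run_cat IHv -cat1s run_cat IHt; apply: (mvK Be).
Qed.

(** * Excursions that light a prescribed set of lamps *)

Section Tour.
Variable c : site -> bool.

Definition light z : seq lamp := if c z then [:: Ep] else [::].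

Fixpoint tourR n (i : Z) : seq lamp :=
  if n is n'.+1 then
    light (i, false) ++ Al :: (light (i, true) ++ Be :: tourR n' (i + 1)%Z ++ [:: Be]) ++ [:: Al]
  else [::].

Fixpoint tourL n (i : Z) : seq lamp :=
  if n is n'.+1 then
    Be :: (light ((i - 1)%Z, true)
      ++ Al :: (light ((i - 1)%Z, false) ++ tourL n' (i - 1)%Z) ++ [:: Al]) ++ [:: Be]
  else [::].

Lemma excursion_light z : excursion (light z).
Proof. by rewrite /light; case: c; repeat constructor. Qed.

Lemma excursion_tourR n i : excursion (tourR n i).
Proof.
elim: n i => [|n IH] i /=; first by constructor.
apply: excursion_cat (excursion_light _) _; apply: Exc_al; last by constructor.
apply: excursion_cat (excursion_light _) _; apply: Exc_be; [exact: IH | by constructor].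
Qed.

Lemma excursion_tourL n i : excursion (tourL n i).
Proof.
elim: n i => [|n IH] i /=; first by constructor.
apply: Exc_be; last by constructor.
apply: excursion_cat (excursion_light _) _; apply: Exc_al; last by constructor.
exact: excursion_cat (excursion_light _) (IH _).
Qed.

Lemma par_light z x : par z x (light x) = c x && (x == z).
Proof. by rewrite /light; case: c => //=; rewrite addbF. Qed.

Lemma par_Al z x w : par z x (Al :: w) = par z (mv Al x) w.
Proof. by []. Qed.

Lemma par_Be z x w : par z x (Be :: w) = par z (mv Be x) w.
Proof. by []. Qed.

Lemma size_light z : (size (light z) <= 1)%N.
Proof. by rewrite /light; case: c. Qed.

Lemma siteE (x z : site) : (x == z) = Z.eqb x.1 z.1 && (x.2 == z.2).
Proof.
apply/eqP/idP => [->|/andP[/Z.eqb_eq h /eqP h']]; first by rewrite Z.eqb_refl eqxx.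
by case: x z h h' => [i b] [j b'] /= -> ->.
Qed.

Lemma par_tourR z n i :
  par z (i, false) (tourR n i) = c z && (Z.leb i z.1 && Z.ltb z.1 (i + Z.of_nat n)).
Proof.
elim: n i => [|n IH] i.
  by rewrite /=; case: Z.leb_spec; case: Z.ltb_spec => //=; rewrite ?andbF //; lia.
rewrite -[tourR _ _]/(light (i, false) ++ Al :: (light (i, true) ++ Be :: tourR n (i + 1)%Z ++ [:: Be]) ++ [:: Al]).
rewrite par_cat par_light (excursion_run _ (excursion_light _)) par_Al par_cat (par_cat _ _ (light _)).
rewrite par_light (excursion_run _ (excursion_light _)) par_Be par_cat IH par_Al par_Be /= !addbF.
rewrite !siteE /=; case: z {IH} => j b /=.
case: (Z.eqb_spec i j) => [<-|hij] /=.
  case: Z.leb_spec => [|_]; first lia.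
  have -> : (i <=? i)%Z by lia.
  have -> : (i <? i + Z.of_nat n.+1)%Z by lia.
  by rewrite /= !andbF !andbT; case: b; rewrite /= ?andbF ?andbT ?addbF //.
rewrite !andbF /=; congr andb.
by case: Z.leb_spec; case: Z.leb_spec; case: Z.ltb_spec; case: Z.ltb_spec => //=; lia.
Qed.

Lemma par_tourL z n i :
  par z (i, false) (tourL n i) = c z && (Z.leb (i - Z.of_nat n) z.1 && Z.ltb z.1 i).
Proof.
elim: n i => [|n IH] i.
  by rewrite /=; case: Z.leb_spec; case: Z.ltb_spec => //=; rewrite ?andbF //; lia.
rewrite -[tourL _ _]/(Be :: (light ((i - 1)%Z, true)
  ++ Al :: (light ((i - 1)%Z, false) ++ tourL n (i - 1)%Z) ++ [:: Al]) ++ [:: Be]).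
rewrite par_Be par_cat (par_cat _ _ (light _)) par_light (excursion_run _ (excursion_light _)).
rewrite par_Al par_cat (par_cat _ _ (light _)) par_light (excursion_run _ (excursion_light _)).
rewrite IH par_Al par_Be /= !addbF.
rewrite !siteE /=; case: z {IH} => j b /=.
case: (Z.eqb_spec (i - 1) j) => [<-|hij] /=.
  have -> : (i - 1 <? i - 1)%Z = false by lia.
  have -> : (i - Z.of_nat n.+1 <=? i - 1)%Z by lia.
  have -> : (i - 1 <? i)%Z by lia.
  by rewrite /= !andbF !andbT; case: b; rewrite /= ?andbF ?andbT ?addbF //.
rewrite !andbF /=; congr andb.
by case: Z.leb_spec; case: Z.leb_spec; case: Z.ltb_spec; case: Z.ltb_spec => //=; lia.
Qed.

Lemma size_tourR n i : (size (tourR n i) <= 6 * n)%N.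
Proof.
elim: n i => [|n IH] i //=; rewrite !(size_cat, size_cat) /= !size_cat /= size_cat /=.
by have := IH (i + 1)%Z; have := size_light (i, false); have := size_light (i, true); lia.
Qed.

Lemma size_tourL n i : (size (tourL n i) <= 6 * n)%N.
Proof.
elim: n i => [|n IH] i //=; rewrite !size_cat /= !size_cat /=.
have := IH (i - 1)%Z; have := size_light ((i - 1)%Z, false); have := size_light ((i - 1)%Z, true).
lia.
Qed.

(** [tourR r.+1 0] serves the cells 0 to r and [tourL r 0] the cells -r to -1, each at a cost of at
    most 6 letters: four moves and two switches. *)
Lemma tour_ex (r : nat) : (forall z, c z -> (Z.abs z.1 <= Z.of_nat r)%Z) ->
  exists w, [/\ excursion w, forall z, par z base w = c z & (size w <= 12 * r + 6)%N].
Proof.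
move=> hc; exists (tourR r.+1 0 ++ tourL r 0); split.
- exact: excursion_cat (excursion_tourR _ _) (excursion_tourL _ _).
- move=> z; rewrite par_cat (excursion_run _ (excursion_tourR _ _)) par_tourR par_tourL.
  case h: (c z) => //=; have := hc _ h.
  by case: Z.leb_spec; case: Z.leb_spec; case: Z.ltb_spec; case: Z.ltb_spec => //=; lia.
- by rewrite size_cat; have := size_tourR r.+1 0; have := size_tourL r 0; lia.
Qed.

End Tour.

(** * Short words for lamplighter elements *)

Lemma bounded_choice A (P : nat -> seq A -> Prop) (N : nat) : exists C, forall i, (i < N)%N ->
  (exists w, P i w) -> exists w, P i w /\ (size w <= C)%N.
Proof.
elim: N => [|N [C hC]]; first by exists 0%N.
have [[w hw]|h] := classic (exists w, P N w).
  exists (maxn C (size w)) => i; rewrite ltnS leq_eqVlt => /orP[/eqP -> _|hi /(hC _ hi) [v [hv hs]]].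
    by exists w; rewrite leq_maxr.
  by exists v; rewrite leq_max hs.
exists C => i; rewrite ltnS leq_eqVlt => /orP[/eqP -> //|]; exact: hC.
Qed.

Section Subgroup.
Variables (A : Type) (inv : A -> A) (S : seq A -> Prop) (ps : seq A -> site).
Hypothesis S_nil : S [::].
Hypothesis S_cat : forall w v, S w -> S v -> S (w ++ v).
Hypothesis S_inv : forall w, S w -> S (winv inv w).
Hypothesis ps_nil : ps [::] = base.
Hypothesis ps_cat : forall w v, ps (w ++ v) = shift (ps w) (ps v).
Hypothesis ps_inv : forall w, ps (winv inv w ++ w) = base.

Lemma ps_translation_inv t j : ps t = (j, false) -> ps (winv inv t) = ((- j)%Z, false).
Proof.
move=> h; move: (ps_inv t); rewrite ps_cat h; case: (ps _) => q [] //=.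
by rewrite /shift /= => -[e]; congr pair; lia.
Qed.

Definition short C w v := [/\ S v, ps v = ps w & (size v <= C * (Z.to_nat (Z.abs (ps w).1) + 1))%N].

(** Multiplying by [t] or its inverse brings the position into the cells 0 to j - 1, where one
    stored word per site suffices. While the position stays outside, each factor lowers its absolute
    value by [j >= 1], so the length is linear. *)
Lemma short_translation t j : S t -> ps t = (j, false) -> (0 < j)%Z ->
  exists C, forall w, S w -> exists v, short C w v.
Proof.
move=> St pt j0.
have [C1 h1] := bounded_choice (fun i w => S w /\ ps w = (Z.of_nat i, false)) (Z.to_nat j).
have [C2 h2] := bounded_choice (fun i w => S w /\ ps w = (Z.of_nat i, true)) (Z.to_nat j).
have small w : S w -> (0 <= (ps w).1 < j)%Z ->
    exists v, [/\ S v, ps v = ps w & (size v <= maxn C1 C2)%N].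
  move=> Sw; case e: (ps w) => [q b] /= hq.
  have hi : (Z.to_nat q < Z.to_nat j)%N by lia.
  case: b e => e; [case: (h2 _ hi) | case: (h1 _ hi)]; try (exists w; split=> //; rewrite e; congr pair; lia).
    move=> v [[Sv ev] sv]; exists v; split=> //; last by rewrite leq_max sv orbT.
    by rewrite ev; congr pair; lia.
  move=> v [[Sv ev] sv]; exists v; split=> //; last by rewrite leq_max sv.
  by rewrite ev; congr pair; lia.
exists (size t + maxn C1 C2)%N.
have step k w : S w -> (Z.abs (ps w).1 <= Z.of_nat k)%Z -> exists v, short (size t + maxn C1 C2) w v.
  elim: k w => [|k IH] w Sw hk.
    have [|v [h3 h4 h5]] := small w Sw; first lia.
    by exists v; split=> //; nia.
  have [hlt|hge] := Z_lt_ge_dec (ps w).1 j; last first.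
    have e : ps (winv inv t ++ w) = (((ps w).1 - j)%Z, (ps w).2).
      rewrite ps_cat (ps_translation_inv pt); case: (ps w) => q b.
      by rewrite /shift /=; congr pair; lia.
    have [||v [h3 h4 h5]] := IH (winv inv t ++ w); [by apply: S_cat => //; apply: S_inv | by rewrite e /=; lia|].
    exists (t ++ v); split; first exact: S_cat.
      rewrite ps_cat h4 e pt; case: (ps w) => q b.
      by rewrite /shift /=; congr pair; lia.
    rewrite size_cat; move: h5; rewrite e /=.
    have -> : Z.to_nat (Z.abs ((ps w).1 - j)) = (Z.to_nat (Z.abs (ps w).1) - Z.to_nat j)%N by lia.
    have : (Z.to_nat j <= Z.to_nat (Z.abs (ps w).1))%N by lia.
    have : (0 < Z.to_nat j)%N by lia.
    set a := Z.to_nat j; set b := Z.to_nat _; nia.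
  have [hneg|hpos] := Z_lt_ge_dec (ps w).1 0; last first.
    have [|v [h3 h4 h5]] := small w Sw; first lia.
    by exists v; split=> //; nia.
  have e : ps (t ++ w) = (((ps w).1 + j)%Z, (ps w).2).
    by rewrite ps_cat pt; case: (ps w) => q b; rewrite /shift /=; congr pair; lia.
  have Stw : S (t ++ w) by apply: S_cat.
  have hback v : ps v = ps (t ++ w) -> ps (winv inv t ++ v) = ps w.
    move=> h; rewrite ps_cat h e (ps_translation_inv pt).
    by case: (ps w) => q b; rewrite /shift /=; congr pair; lia.
  have [hlt2|hge2] := Z_lt_ge_dec ((ps w).1 + j) 0.
    have [|v [h3 h4 h5]] := IH (t ++ w) Stw; first by rewrite e /=; lia.
    exists (winv inv t ++ v); split; [by apply: S_cat => //; apply: S_inv | exact: hback |].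
    rewrite size_cat size_winv; move: h5; rewrite e /=.
    have -> : Z.to_nat (Z.abs ((ps w).1 + j)) = (Z.to_nat (Z.abs (ps w).1) - Z.to_nat j)%N by lia.
    have : (Z.to_nat j <= Z.to_nat (Z.abs (ps w).1))%N by lia.
    have : (0 < Z.to_nat j)%N by lia.
    set a := Z.to_nat j; set b := Z.to_nat _; nia.
  have [|v [h3 h4 h5]] := small _ Stw; first by rewrite e /=; lia.
  exists (winv inv t ++ v); split; [by apply: S_cat => //; apply: S_inv | exact: hback |].
  by rewrite size_cat size_winv; nia.
by move=> w Sw; apply: (step (Z.to_nat (Z.abs (ps w).1))) => //; lia.
Qed.

(* Either S contains a translation, or it has at most one non-trivial element. *)
Lemma undistorted : exists C, forall w, S w -> exists v, short C w v.
Proof.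
have [[t [j [St pt hj]]]|hno] := classic (exists t j, [/\ S t, ps t = (j, false) & j <> 0%Z]).
  have [h|h] := Z_lt_ge_dec 0 j; first exact: (short_translation St pt h).
  apply: (short_translation (S_inv St) (ps_translation_inv pt)); lia.
have [[r [q [Sr pr]]]|hno2] := classic (exists r q, S r /\ ps r = (q, true)); last first.
  exists 0%N => w Sw; exists [::]; split=> //; rewrite ps_nil.
  case e: (ps w) => [i []]; first by case: hno2; exists w, i.
  case: (Z.eq_dec i 0) => [-> //|hi]; case: hno; exists w, i; split=> //.
exists (size r) => w Sw; case e: (ps w) => [i []].
  exists r; split=> //; last by nia.
  rewrite pr e; case: (Z.eq_dec q i) => [-> //|hi].
  case: hno; exists (r ++ w), (q - i)%Z; split; [exact: S_cat | | lia].
  by rewrite ps_cat pr e /shift.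
exists [::]; split=> //; rewrite ps_nil e.
case: (Z.eq_dec i 0) => [-> //|hi]; case: hno; exists w, i; split=> //.
Qed.

End Subgroup.

Section Short.
Variables (A : Type) (inv : A -> A) (G : seq A -> seq A -> Prop) (lm : A -> lamp) (lift : lamp -> A).
Hypothesis cG : congruence inv G.
Hypothesis lm_inv : forall a, lm (inv a) = lm a.
Hypothesis lm_lift : forall a, a <> Neutral -> lm (lift a) = a.
Hypothesis G_ep : G [:: lift Ep] [::].
Hypothesis inv_al : inv (lift Al) = lift Al.
Hypothesis inv_be : inv (lift Be) = lift Be.

Local Notation lmw := (map lm).

Lemma congruence_lamp : congruence inv (fun w v => eqL (lmw w) (lmw v)).
Proof. exact: (congruence_map congruence_eqL). Qed.

Lemma congruence_base : congruence inv (fun w v => G w v /\ eqL (lmw w) (lmw v)).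
Proof. exact: (congruence_and cG congruence_lamp). Qed.

Lemma excursion_lm w : excursion w -> lmw (map lift w) = w.
Proof.
by elim=> [//|v _ IH|v t _ IHv _ IHt|v t _ IHv _ IHt] /=; rewrite ?map_cat /= ?IH ?IHv ?IHt !lm_lift.
Qed.

(** An excursion cancels as soon as the letters for [Al] and [Be] are involutions and the one for
    [Ep] is trivial. *)
Lemma excursion_G w : excursion w -> G (map lift w) [::].
Proof.
have hsq a u : inv (lift a) = lift a -> G u [::] -> G (lift a :: u ++ [:: lift a]) [::].
  move=> ha hu; have := cong_invl cG (lift a); rewrite ha; apply: (cong_trans cG).
  rewrite -cat1s -[[:: _; _]]/([:: lift a] ++ [::] ++ [:: lift a]).
  by apply: (cong_catr cG); apply: (cong_catl cG).
have hcat u v : G u [::] -> G v [::] -> G (u ++ v) [::].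
  by move=> hu hv; apply: (cong_cat cG hu hv).
have hsplit (a : A) u s : a :: u ++ a :: s = (a :: u ++ [:: a]) ++ s by rewrite /= -catA.
elim=> [|v _ IH|v t _ IHv _ IHt|v t _ IHv _ IHt] /=.
- exact: (cong_refl cG).
- by rewrite -cat1s; apply: hcat.
- by rewrite map_cat /= hsplit; apply: hcat => //; apply: hsq.
- by rewrite map_cat /= hsplit; apply: hcat => //; apply: hsq.
Qed.

(** Words that are trivial modulo [G] and leave all lamps unchanged. In the product they are
    determined by their position [endp], so they amount to a subgroup of the infinite dihedral
    group. *)
Definition dark w := G w [::] /\ forall z, par z base (lmw w) = false.
Definition endp w := run mv (lmw w) base.

Lemma endp_cat w v : endp (w ++ v) = shift (endp w) (endp v).
Proof. by rewrite /endp map_cat run_cat shift_run shift_base. Qed.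

Lemma dark_any w x z : (forall z, par z base (lmw w) = false) -> par z x (lmw w) = false.
Proof. by move=> h; rewrite -(shift_base x); have [y <-] := shift_surj x z; rewrite par_shift. Qed.

Lemma endp_inv w : endp (winv inv w ++ w) = base.
Proof. by have [h _] := cong_winvl congruence_lamp w base. Qed.

Lemma dark_cat w v : dark w -> dark v -> dark (w ++ v).
Proof.
move=> [h1 h2] [h3 h4]; split; first exact: (cong_cat cG h1 h3).
by move=> z; rewrite map_cat par_cat h2 dark_any.
Qed.

Lemma dark_inv w : dark w -> dark (winv inv w).
Proof.
move=> [h1 h2]; split.
  exact: (cong_winv cG h1).
move=> z; have [_ /(_ z)] := cong_winvl congruence_lamp w base.
by rewrite map_cat par_cat (dark_any _ _ h2) addbF.
Qed.

(** A shortest [G]-representative [v] of [w] is corrected in two steps. A tour, trivial modulo [G],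
    sets the lamps of [w] times the inverse of [v]; what remains is dark, and [undistorted] replaces
    it by a word of length linear in its position. Both costs are controlled by the range of [w]
    plus the length of [v]. *)
Lemma short_word : exists C, forall w, exists z, (G z w /\ eqL (lmw z) (lmw w)) /\
  (size z <= C * (nrm G w + Z.to_nat (far base (lmw w)) + 1))%N.
Proof.
have [C hC] : exists C, forall w, dark w -> exists v, short dark endp C w v.
  apply: (undistorted (inv := inv)).
  - by split; [exact: (cong_refl cG) |].
  - exact: dark_cat.
  - exact: dark_inv.
  - by [].
  - exact: endp_cat.
  - exact: endp_inv.
(* 12 and 6 are the constants of the tour, and 1 accounts for [v]. *)
exists (C + 19)%N => w.
have [v [sv Gv]] := nrm_ex (cong_refl cG w).
pose w1 := w ++ winv inv v.
set r := Z.to_nat (far base (lmw w)).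
have r_far : far base (lmw w) = Z.of_nat r by have := far_start base (lmw w); rewrite /r /=; lia.
have Gw1 : G w1 [::] by apply/(cong_divr cG)/(cong_sym cG).
have hfar : (far base (lmw w1) <= Z.of_nat (r + size v))%Z.
  rewrite map_cat far_cat r_far.
  have := far_size (run mv (lmw w) base) (lmw (winv inv v)).
  rewrite size_map size_winv; have := far_end base (lmw w); rewrite r_far; lia.
have [u [eu pu su]] := tour_ex (c := fun z => par z base (lmw w1)) (r := (r + size v)%N)
  (fun z hz => Z.le_trans _ _ _ (par_far hz) hfar).
pose z1 := map lift u.
have lz1 : lmw z1 = u by apply: excursion_lm.
have Gz1 : G z1 [::] by apply: excursion_G.
have e1 : run mv (lmw (winv inv z1)) base = base.
  by have := endp_inv z1; rewrite endp_cat /endp lz1 (excursion_run _ eu) shift_base.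
pose w2 := winv inv z1 ++ w1.
have hu z : par z base (lmw (winv inv z1)) = par z base u.
  have [_ /(_ z)] := cong_winvl congruence_lamp z1 base.
  by rewrite map_cat par_cat lz1 e1 /=; case: par; case: par.
have dw2 : dark w2.
  split; first by apply: (cong_cat cG (w' := [::])) => //; apply: (cong_winv cG Gz1).
  by move=> z; rewrite map_cat par_cat e1 hu pu addbb.
have pw2 : endp w2 = endp w1 by rewrite /endp map_cat run_cat e1.
have [v2 [[Gv2 dv2] pv2 sv2]] := hC _ dw2.
have L1 : eqL (lmw (z1 ++ v2)) (lmw w1).
  apply: eqL_base; first by rewrite map_cat run_cat lz1 (excursion_run _ eu); rewrite -/(endp v2) pv2 pw2.
  by move=> z; rewrite map_cat par_cat lz1 (excursion_run _ eu) dv2 pu addbF.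
exists (z1 ++ v2 ++ v); split; first split.
- apply: (cong_trans cG _ Gv).
  by apply: (cong_cat cG (w' := [::]) Gz1); apply: (cong_cat cG (w' := [::]) Gv2 (cong_refl cG v)).
- rewrite catA; apply: (cong_trans congruence_lamp (v := w1 ++ v)).
    exact: (cong_catl congruence_lamp v L1).
  rewrite /w1 -catA; have h := cong_catr congruence_lamp w (cong_winvl congruence_lamp v).
  by rewrite cats0 in h.
- rewrite !size_cat size_map -sv; move: sv2; rewrite pw2 /endp.
  have := far_end base (lmw w1).
  set a := Z.to_nat _ => ha; have : (a <= r + size v)%N by rewrite /a; lia.
  nia.
Qed.

End Short.

(** * Finite groups acting on trees of segments *)

#[local] Arguments Z.mul : simpl never.

Section TreeAction.
Variables (k : Z) (ok : nat -> bool).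

(* Vertices of a tree of segments: [u] is the segment, [i] in [-2k, 2k] the cell and [b] the
   half-cell.  The segment [s :: u] is attached by its middle to the cell k or -k of [u]. *)
Definition vertex := (seq bool * Z * bool)%type.

(** The involution exchanging the two ends of each edge between segments. The edges between depths n
    and n + 1 are open when [ok n] holds: always for the infinite tree, below a bound for a
    truncated one. *)
Definition jump (x : seq bool * Z) : seq bool * Z :=
  let: (u, i) := x in
  if Z.eqb i 0 then
    if u is s :: u' then if ok (size u') then (u', if s then k else (- k)%Z) else x else x
  else if Z.eqb i k && ok (size u) then (true :: u, 0%Z)
  else if Z.eqb i (- k) && ok (size u) then (false :: u, 0%Z)
  else x.

Definition ymv (a : lamp) (y : vertex) : vertex :=
  let: (u, i, b) := y in
  match a with
  | Neutral => y
  | Al => (u, i, ~~ b)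
  | Be => if b then if Z.eqb i (2 * k) then y else (u, (i + 1)%Z, false)
          else if Z.eqb i (- (2 * k)) then y else (u, (i - 1)%Z, true)
  | Ep => if b then y else (jump (u, i), false)
  end.

Definition cell_ok (y : vertex) : Prop := (Z.abs y.1.2 <= 2 * k)%Z.

Hypothesis k0 : (0 < k)%Z.

Arguments jump : simpl never.

Lemma jumpK : involutive jump.
Proof.
have hk0 : (k =? 0)%Z = false by lia.
have hk1 : (- k =? 0)%Z = false by lia.
have hk2 : (- k =? k)%Z = false by lia.
case=> u i; rewrite /jump.
case: (Z.eqb_spec i 0) => [->|hi].
  case: u => [//|s u] /=; case h: (ok (size u)); last by rewrite /= h.
  by case: s; rewrite ?hk0 ?hk1 ?hk2 ?Z.eqb_refl h.
case h: (ok (size u)); last by rewrite !andbF; case: Z.eqb_spec => // _; rewrite h !andbF.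
rewrite !andbT; case: (Z.eqb_spec i k) => [->|hik] /=; first by rewrite h.
case: (Z.eqb_spec i (- k)) => [->|hik'] /=; first by rewrite h.
case: Z.eqb_spec => // _; rewrite h !andbT.
by case: Z.eqb_spec => // _; case: Z.eqb_spec.
Qed.

Lemma ymvK a y : cell_ok y -> ymv a (ymv a y) = y.
Proof.
case: y => [[u i] b]; rewrite /cell_ok /= => hi.
case: a => //=.
- by rewrite negbK.
- case: b.
    case: Z.eqb_spec => h /=; first by rewrite h Z.eqb_refl.
    case: Z.eqb_spec => h' /=; first lia.
    by congr (_, _, _); lia.
  case: Z.eqb_spec => h /=; first by rewrite h Z.eqb_refl.
  case: Z.eqb_spec => h' /=; first lia.
  by congr (_, _, _); lia.
- by case: b => //; have := jumpK (u, i); case: (jump (u, i)) => u' i' /= ->.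
Qed.

Lemma jump_cell x : (Z.abs x.2 <= 2 * k)%Z -> (Z.abs (jump x).2 <= 2 * k)%Z.
Proof.
case: x => u i /= hi; rewrite /jump.
case: Z.eqb => //=; first by case: u => [|s u] //=; case: (ok _) => //=; case: s; lia.
by case: ifP => //= _; [lia | case: ifP => //=; lia].
Qed.

Lemma ymv_cell a y : cell_ok y -> cell_ok (ymv a y).
Proof.
case: y => [[u i] b]; rewrite /cell_ok; case: a => //=.
- by case: b; case: Z.eqb_spec => //=; lia.
- case: b => // hi; have := @jump_cell (u, i) hi.
  by case: (jump _).
Qed.

Section Relation.
Variables (u : seq bool) (q : Z).
Hypothesis hq : [\/ q = 0%Z, q = k | q = (- k)%Z].

(** Coordinates near a junction: [x] is the position relative to it and [p] tells which of the two
    segments meeting there is occupied. Segments extend to 2k so that even around the cells k and -k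
    a whole interval of radius k is available. *)
Definition sheet (p : bool) (x : site) : vertex :=
  let: (u', q') := if p then jump (u, q) else (u, q) in (u', (q' + x.1)%Z, x.2).

Lemma jump_special : [\/ (jump (u, q)).2 = 0%Z, (jump (u, q)).2 = k | (jump (u, q)).2 = (- k)%Z].
Proof.
rewrite /jump; case: ifP => _; last by do 2 (case: ifP => _; first by apply: Or31).
by case: u => [//|s u']; case: ifP => // _; case: s; [apply: Or32 | apply: Or33].
Qed.

Lemma jump_off v j : j <> 0%Z -> j <> k -> j <> (- k)%Z -> jump (v, j) = (v, j).
Proof.
by move=> h1 h2 h3; rewrite /jump; do 3 (case: Z.eqb_spec => //= _).
Qed.

Lemma sheet_mv a p x : (Z.abs x.1 < k)%Z ->
  ymv a (sheet p x) = sheet (p (+) toggles a x base) (mv a x).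
Proof.
move=> hx.
have [u' [q' [e hq' hj]]] : exists u' q', [/\ (if p then jump (u, q) else (u, q)) = (u', q'),
    [\/ q' = 0%Z, q' = k | q' = (- k)%Z] &
    jump (u', q') = if p then (u, q) else jump (u, q)].
  case: p; last by exists u, q.
  have := jump_special; have := jumpK (u, q).
  by case: (jump (u, q)) => u' q' h1 h2; exists u', q'.
rewrite /sheet e; case: x hx => i b /= hx.
have hq2 : (Z.abs q' <= k)%Z by case: hq' => ->; lia.
case: a => //=; rewrite ?addbF ?e //.
- by case: b; (case: Z.eqb_spec => [h|_]; first by lia) => /=; congr (_, _, _); lia.
- rewrite siteE /= andbC; case: b; first by rewrite /= addbF e.
  case: (Z.eqb_spec i 0) => [->|hi] /=.
    rewrite Z.add_0_r hj addbT; case: p {e hj} => //=; first by rewrite Z.add_0_r.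
    by case: (jump (u, q)) => u1 q1; rewrite Z.add_0_r.
  rewrite addbF e jump_off //; case: hq' => ->; lia.
Qed.

(** Near a junction a short word acts through its position and the parity of the single lamp at
    [base]: this is the quotient of the lamplighter that it sees. *)
Lemma sheet_run w p x : (Z.abs x.1 + Z.of_nat (size w) <= k)%Z ->
  run ymv w (sheet p x) = sheet (p (+) par base x w) (run mv w x).
Proof.
elim: w p x => [|a w IH] p x; first by rewrite /= addbF.
rewrite -[size (a :: w)]/((size w).+1) Nat2Z.inj_succ => h.
rewrite /= -!/(run _ _ _) sheet_mv; last lia.
by rewrite IH ?addbA //; have := mv_abs a x; lia.
Qed.

End Relation.

(** The line folded onto the segment at its two ends, where [Be] fixes the last half-cell. *)
Definition fold_site (x : site) : site :=
  if Z.ltb (2 * k) x.1 then ((4 * k + 1 - x.1)%Z, ~~ x.2)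
  else if Z.ltb x.1 (- (2 * k)) then ((- (4 * k) - 1 - x.1)%Z, ~~ x.2) else x.

Lemma fold_run u w x : (Z.abs x.1 + Z.of_nat (size w) <= 4 * k)%Z ->
  (forall q, [\/ q = 0%Z, q = k | q = (- k)%Z] ->
     (Z.of_nat (size w) < Z.abs ((fold_site x).1 - q))%Z) ->
  run ymv w (u, (fold_site x).1, (fold_site x).2) =
  (u, (fold_site (run mv w x)).1, (fold_site (run mv w x)).2).
Proof.
elim: w x => [//|a w IH] x.
rewrite -[size (a :: w)]/((size w).+1) Nat2Z.inj_succ => h hq.
have hs : ymv a (u, (fold_site x).1, (fold_site x).2) =
    (u, (fold_site (mv a x)).1, (fold_site (mv a x)).2) /\
    (Z.abs ((fold_site (mv a x)).1 - (fold_site x).1) <= 1)%Z.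
  have h0 := hq 0%Z (Or31 _ _ erefl); have h1 := hq k (Or32 _ _ erefl).
  have h2 := hq (- k)%Z (Or33 _ _ erefl); move: h0 h1 h2.
  case: x h {hq} => i b /= h.
  case: a => /=.
  - by move=> *; split=> //; lia.
  - move=> *; rewrite /fold_site /=.
    by case: (2 * k <? i)%Z; [|case: (i <? - (2 * k))%Z]; split=> //=; lia.
  - rewrite /fold_site /=; case: b => /=; do ?(case: Z.ltb_spec => ? /=); move=> *;
      try lia; (split; last lia); try (case: Z.eqb_spec => ?; try lia); congr (_, _, _); lia.
  - move=> h0 h1 h2; split; last lia.
    by case: (fold_site _) h0 h1 h2 => j [] //= h0 h1 h2; rewrite jump_off //; lia.
have [e1 e2] := hs.
rewrite -[LHS]/(run ymv w (ymv a (u, (fold_site x).1, (fold_site x).2))) e1 IH //.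
  by have := mv_abs a x; lia.
by move=> q /hq; lia.
Qed.

(** If the start is within the length of [w] from a junction, the path stays in the region described
    by [sheet]. Otherwise it meets no junction, every [Ep] acts trivially, and only the folded line
    remains. *)
Lemma relation w y : (4 * Z.of_nat (size w) < k)%Z -> cell_ok y -> eqL w [::] -> run ymv w y = y.
Proof.
case: y => [[u i] b]; rewrite /cell_ok /= => hw hi hL.
have [[q [hq hqi]]|hfar] := classic (exists q, [\/ q = 0%Z, q = k | q = (- k)%Z] /\
    (Z.abs (i - q) <= Z.of_nat (size w))%Z).
  have -> : (u, i, b) = sheet u q false ((i - q)%Z, b) by rewrite /sheet /=; congr (_, _, _); lia.
  rewrite sheet_run //=; last lia.
  by have [-> ->] := hL ((i - q)%Z, b).
have hf : fold_site (i, b) = (i, b).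
  by rewrite /fold_site /=; do 2 (case: Z.ltb_spec => //; first lia).
have := @fold_run u w (i, b); rewrite (hL (i, b)).1 /= hf; apply; first lia.
move=> q hq; case: (Z_lt_ge_dec (Z.of_nat (size w)) (Z.abs (i - q))) => // h.
by case: hfar; exists q; split=> //; lia.
Qed.

Lemma depth_jump x : (size (jump x).1 <= (size x.1).+1)%N.
Proof.
case: x => u i; rewrite /jump /=; case: ifP => _; first by case: u => [|s u] //=; case: ifP => //= _; lia.
by do 2 (case: ifP => _ //=).
Qed.

Lemma depth_run w (y : vertex) : (size (run ymv w y).1.1 <= size y.1.1 + size w)%N.
Proof.
elim: w y => [|a w IH] y /=; first by rewrite addn0.
apply: (leq_trans (IH _)); rewrite -addSnnS leq_add2r.
case: y => [[u i] b]; case: a => //=.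
- by case: b; case: ifP.
- by case: b => //; have := depth_jump (u, i); case: jump.
Qed.

End TreeAction.

Arguments jump : simpl never.

(** * Finite trees and their congruences *)

Section Truncation.
Variables (k : Z) (D : nat).
Hypothesis k0 : (0 < k)%Z.

Definition below (n : nat) : bool := (n < D)%N.
Definition tmv := ymv k below.
Definition valid (y : vertex) : Prop := cell_ok k y /\ (size y.1.1 <= D)%N.
Definition eqT (w v : seq lamp) : Prop := forall y, valid y -> run tmv w y = run tmv v y.
Definition root : vertex := ([::], 0%Z, false).

Lemma valid_root : valid root.
Proof. by split=> //; rewrite /cell_ok /=; lia. Qed.

Lemma valid_tmv a y : valid y -> valid (tmv a y).
Proof.
case=> h1 h2; split; first exact: ymv_cell.
case: y h1 h2 => [[u i] b] _ /= h; case: a => //=.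
- by case: b; case: ifP.
- case: b => //=; rewrite /jump /=; case: ifP => _ /=.
    by case: u h => [|s u] //= h; case: ifP => //= _; lia.
  case: ifP => [/andP[_ ?] //|_]; by case: ifP => [/andP[_ ?] //|_].
Qed.

Lemma congruence_eqT : congruence (@id lamp) eqT.
Proof.
apply: congruence_run; first by move=> a x; apply: valid_tmv.
  by move=> a x [h _]; apply: ymvK.
by move=> a x [h _]; apply: ymvK.
Qed.

Lemma eqT_relation w v : (4 * Z.of_nat (size w + size v) < k)%Z -> eqL w v -> eqT w v.
Proof.
move=> hk hL.
have h : eqT (w ++ winv (@id lamp) v) [::].
  move=> y [hy _]; apply: relation => //; first by rewrite size_cat size_winv.
  exact/(cong_divr congruence_eqL).
exact/(cong_divr congruence_eqT).
Qed.

Lemma tmv_run w y : (size y.1.1 + size w <= D)%N -> run tmv w y = run (ymv k xpredT) w y.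
Proof.
elim: w y => [//|a w IH] y /=; rewrite -addSnnS => h.
have -> : tmv a y = ymv k xpredT a y.
  case: y h => [[u i] b] /= h; case: a => //=; case: b => //=; rewrite /jump.
  have h1 : below (size u) by rewrite /below; lia.
  rewrite h1; case: ifP => // _; case: u h h1 => [//|s u] /= h h1.
  by have -> : below (size u) by rewrite /below; lia.
apply: IH; apply: leq_trans h; rewrite leq_add2r.
by have := @depth_run k xpredT [:: a] y; rewrite addn1.
Qed.

(** One letter raises the depth by at most one, so the depth reached from the root bounds the length
    of every representative from below. *)
Lemma depth_eqT w v : eqT w v -> (size (run tmv w root).1.1 <= size v)%N.
Proof. by move=> /(_ _ valid_root) ->; apply: depth_run. Qed.

Lemma valid_finite : exists ys : seq vertex, forall y, valid y -> y \in ys.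
Proof.
have [us hus] : exists us : seq (seq bool), forall u : seq bool, (size u <= D)%N -> u \in us.
  elim: (D) => [|n [us hus]]; first by exists [:: [::]] => -[].
  exists ([::] :: map (cons true) us ++ map (cons false) us) => -[//|s u] /= /hus hu.
  rewrite inE mem_cat; apply/orP; right; apply/orP.
  by case: s; [left | right]; apply: map_f.
exists [seq (x, b) | x <- [seq (u, (Z.of_nat n - 2 * k)%Z) | u <- us, n <- iota 0 (Z.to_nat (4 * k + 1))],
                     b <- [:: true; false]].
move=> [[u i] b] [hi hu]; rewrite /cell_ok /= in hi hu.
apply/allpairsP; exists ((u, i), b); split=> //=; last by case: b.
apply/allpairsP; exists (u, Z.to_nat (i + 2 * k)); split=> //=; first exact: hus.
  by rewrite mem_iota /=; lia.
by congr pair; lia.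
Qed.

Lemma eqT_finite : exists (Q : finType) (q : seq lamp -> Q), forall w v, q w = q v -> eqT w v.
Proof.
have [ys hys] := valid_finite.
exists {ffun 'I_(size ys) -> 'I_(size ys).+1}.
exists (fun w => [ffun c : 'I_(size ys) => inord (index (run tmv w (nth root ys c)) ys)]).
move=> w v /ffunP h y hy.
have hv u : valid (run tmv u y) by elim: u y hy => [//|a u IH] y hy; apply/IH/valid_tmv.
have hc : (index y ys < size ys)%N by rewrite index_mem hys.
move: (h (Ordinal hc)); rewrite !ffunE /= nth_index ?hys // => /(congr1 val).
rewrite /= !inordK ?ltnS ?index_size // => /(congr1 (nth root ys)).
by rewrite !nth_index ?hys.
Qed.

End Truncation.

(** * Range and drift of the walk *)

Local Notation iter := ssrnat.iter.

Local Open Scope R_scope.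

Section Operators.
Variables (X : Type) (act : lamp -> X -> X) (r : R).
Implicit Types f g : X -> R.

Definition PE f x := (f x + f (act Ep x)) / 2.
Definition PA f x := (f x + f (act Al x)) / 2.
Definition PB f x := (1 - r) * f x + r * f (act Be x).
(** The transition operator of one lifted step: the letters [Ep], [Al], [Be], [Al], [Ep] in turn,
    each executed according to its own coin; the coin of [Be] has bias [r], the others are fair. *)
Definition PT f := PE (PA (PB (PA (PE f)))).

Hypothesis r01 : 0 <= r <= 1.
Variable P : X -> Prop.
Hypothesis P_act : forall a x, P x -> P (act a x).

Definition lef f g := forall x, P x -> f x <= g x.

Lemma PE_le f g : lef f g -> lef (PE f) (PE g).
Proof. by move=> h x hx; rewrite /PE; have := h _ hx; have := h _ (P_act Ep hx); lra. Qed.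

Lemma PA_le f g : lef f g -> lef (PA f) (PA g).
Proof. by move=> h x hx; rewrite /PA; have := h _ hx; have := h _ (P_act Al hx); lra. Qed.

Lemma PB_le f g : lef f g -> lef (PB f) (PB g).
Proof.
move=> h x hx; have h1 := h _ hx; have h2 := h _ (P_act Be hx).
by rewrite /PB; apply: Rplus_le_compat; apply: Rmult_le_compat_l; lra.
Qed.

Lemma PT_le f g : lef f g -> lef (PT f) (PT g).
Proof. by move=> h; apply/PE_le/PA_le/PB_le/PA_le/PE_le. Qed.

Lemma PT_add f c x : PT (fun y => f y + c) x = PT f x + c.
Proof. by rewrite /PT /PE /PA /PB /PA /PE; field. Qed.

Lemma PT_scal f c x : PT (fun y => c * f y) x = c * PT f x.
Proof. by rewrite /PT /PE /PA /PB /PA /PE; field. Qed.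

End Operators.

Section Range.
Variable r : R.
Hypothesis r01 : 0 <= r <= 1.

Definition mvmax (a : lamp) (y : site * Z) : site * Z :=
  if a is Be then (mv Be y.1, Z.max y.2 (Z.abs (mv Be y.1).1)) else (mv a y.1, y.2).

Lemma run_mvmax w x m : (Z.abs x.1 <= m)%Z -> (run mvmax w (x, m)).2 = Z.max m (far x w).
Proof.
elim: w x m => [|a w IH] x m hm /=; first lia.
have -> : mvmax a (x, m) = (mv a x, Z.max m (Z.abs (mv a x).1)).
  by case: a => //=; congr pair; lia.
rewrite -/(run _ _ _) IH; last lia.
have := far_start (mv a x) w; lia.
Qed.

Definition cellf (f : Z -> Z -> R) (y : site * Z) : R := f y.1.1 y.2.

(** The coin for [Al] equidistributes the two halves of the cell before [Be] acts, so the cell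
    performs a lazy simple random walk. *)
Lemma PT_cellf f y : PT mvmax r (cellf f) y =
  (1 - r) * f y.1.1 y.2 + r / 2 * (f (y.1.1 + 1)%Z (Z.max y.2 (Z.abs (y.1.1 + 1))) +
                                    f (y.1.1 - 1)%Z (Z.max y.2 (Z.abs (y.1.1 - 1)))).
Proof. by case: y => -[i []] m; rewrite /PT /PE /PA /PB /PA /PE /cellf /=; field. Qed.

Lemma PT_iter_cellf n f : exists g, iter n (PT mvmax r) (cellf f) = cellf g.
Proof.
elim: n => [|n [g IH]]; first by exists f.
rewrite iterS IH; exists (fun i m => (1 - r) * g i m + r / 2 *
  (g (i + 1)%Z (Z.max m (Z.abs (i + 1))) + g (i - 1)%Z (Z.max m (Z.abs (i - 1))))).
by apply: functional_extensionality => y; rewrite PT_cellf.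
Qed.

(* The potential [m^2 - 2 m |i| + 2 i^2] of position i and running maximum m increases by at
   most 2 per step: this is Doob's L^2 inequality in potential form. *)
Lemma PT_iter_max n i b m : (Z.abs i <= m)%Z ->
  iter n (PT mvmax r) (fun y => IZR y.2 * IZR y.2 / 2) ((i, b), m) <=
  IZR m * IZR m - 2 * IZR m * Rabs (IZR i) + 2 * (IZR i * IZR i) + 2 * INR n.
Proof.
pose f (_ m : Z) := IZR m * IZR m / 2.
rewrite -[X in iter _ _ X]/(cellf f).
elim: n i b m => [|n IH] i b m hm.
  (* The potential exceeds [m^2 / 2] by [(m - 2 |i|)^2 / 2]. *)
  rewrite /= /cellf /f /=; have := Rle_0_sqr (IZR m - 2 * Rabs (IZR i)); rewrite /Rsqr.
  have : Rabs (IZR i) * Rabs (IZR i) = IZR i * IZR i by rewrite -Rabs_mult Rabs_pos_eq //; apply: Rle_0_sqr.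
  lra.
rewrite S_INR iterS; have [g e] := PT_iter_cellf n f; rewrite e PT_cellf /=.
have hg j k : (Z.abs j <= k)%Z ->
    g j k <= IZR k * IZR k - 2 * IZR k * Rabs (IZR j) + 2 * (IZR j * IZR j) + 2 * INR n.
  by move=> h; have := IH j b k h; rewrite e.
(* When [|j|] beats the maximum, the true potential [j^2] is smaller than the one computed with the
   old [m], by [(|j| - m)^2]. So [m] may be kept fixed during the step. *)
have hg' j : g j (Z.max m (Z.abs j)) <=
    IZR m * IZR m - 2 * IZR m * Rabs (IZR j) + 2 * (IZR j * IZR j) + 2 * INR n.
  apply: (Rle_trans _ _ _ (hg _ _ (Z.le_max_r _ _))).
  case: (Z_le_gt_dec (Z.abs j) m) => h; first by rewrite Z.max_l //; lra.
  rewrite Z.max_r ?abs_IZR; last lia.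
  have := Rle_0_sqr (Rabs (IZR j) - IZR m); rewrite /Rsqr; lra.
have h0 := hg i m hm; have h1 := hg' (i + 1)%Z; have h2 := hg' (i - 1)%Z.
have hm0 : 0 <= IZR m by apply: IZR_le; lia.
have habs : 2 * Rabs (IZR i) <= Rabs (IZR (i + 1)) + Rabs (IZR (i - 1)).
  have := Rabs_triang (IZR (i + 1)) (IZR (i - 1)).
  rewrite plus_IZR minus_IZR (_ : _ + _ = 2 * IZR i); last ring.
  by rewrite Rabs_mult (Rabs_pos_eq 2); lra.
move: h1 h2; rewrite plus_IZR minus_IZR in habs *; move=> h1 h2.
set A0 := Rabs (IZR i) in habs h0 *; set A1 := Rabs (IZR i + 1) in habs h1.
set A2 := Rabs (IZR i - 1) in habs h2.
have h12 : g (i + 1)%Z (Z.max m (Z.abs (i + 1))) + g (i - 1)%Z (Z.max m (Z.abs (i - 1))) <=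
    2 * (IZR m * IZR m - 2 * IZR m * A0 + 2 * (IZR i * IZR i) + 2 * INR n) + 4 by nra.
set B := IZR m * IZR m - 2 * IZR m * A0 + 2 * (IZR i * IZR i) + 2 * INR n in h0 h12 *.
have : (1 - r) * g i m <= (1 - r) * B by apply: Rmult_le_compat_l; lra.
have : r / 2 * (g (i + 1)%Z (Z.max m (Z.abs (i + 1))) + g (i - 1)%Z (Z.max m (Z.abs (i - 1)))) <=
    r / 2 * (2 * B + 4) by apply: Rmult_le_compat_l; lra.
rewrite /B; lra.
Qed.

Lemma PT_iter_max_base n :
  iter n (PT mvmax r) (fun y => IZR y.2 * IZR y.2) (base, 0%Z) <= 4 * INR n.
Proof.
have := @PT_iter_max n 0 false 0 ltac:(lia).
have -> : forall y, iter n (PT mvmax r) (fun y => IZR y.2 * IZR y.2 / 2) y =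
    iter n (PT mvmax r) (fun y => IZR y.2 * IZR y.2) y / 2.
  elim: n => [|n IH] y //; rewrite !iterS /Rdiv Rmult_comm -PT_scal; congr (PT _ _ _ _).
  by apply: functional_extensionality => z; rewrite IH; lra.
rewrite -/base Rabs_R0; set E := ssrnat.iter _ _ _ _; lra.
Qed.

End Range.

(** * Linear escape in the infinite tree of segments *)

Section Drift.
Variables (k : Z) (r : R).
Hypothesis k0 : (0 < k)%Z.
Hypothesis r01 : 0 < r <= 1.

Let act := ymv k xpredT.
Let valid_cell := cell_ok k.

Let valid_act a y : valid_cell y -> valid_cell (act a y) := @ymv_cell k xpredT k0 a y.

Definition hk : Z := (40 * k * k + k * (k - 1))%Z.

(* Convex except at the cells k and -k, where the sheets one level deeper are attached. *)
Definition hz (i : Z) : Z :=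
  let j := Z.abs i in
  if Z.leb j k then (40 * k * j + j * (j - 1))%Z
  else (hk + (j - k) * (j - k - 1) - 4 * k * (j - k))%Z.

(** The second difference of [hz] with reflection at the ends. It is negative only at the cells k
    and -k; at the ends it is positive because [hz] decreases from k to 2k, which is the purpose of
    its last term. *)
Definition dz (i : Z) : Z :=
  (hz (if Z.eqb i (2 * k) then i else i + 1) + hz (if Z.eqb i (- (2 * k)) then i else i - 1)
   - 2 * hz i)%Z.

Lemma hz_le i : (Z.abs i <= 2 * k)%Z -> (hz i <= 42 * k * k)%Z.
Proof. by rewrite /hz /hk; case: Z.leb_spec; nia. Qed.

Lemma dz_0 : dz 0 = (80 * k)%Z.
Proof.
rewrite /dz /hz; do 2 (case: Z.eqb_spec => [?|_]; first lia).
by do ?(case: Z.leb_spec => ?); lia.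
Qed.

Lemma dz_k i : Z.abs i = k -> dz i = (- (46 * k) + 2)%Z.
Proof.
move=> h; rewrite /dz /hz /hk; do 2 (case: Z.eqb_spec => [?|_]; first lia).
by do ?(case: Z.leb_spec => ?); try lia; nia.
Qed.

Lemma dz_other i : i <> 0%Z -> Z.abs i <> k -> (Z.abs i <= 2 * k)%Z -> (2 <= dz i)%Z.
Proof.
move=> h1 h2 h3; rewrite /dz /hz /hk; do 2 case: Z.eqb_spec => ?;
 do ?(case: Z.leb_spec => ?); try lia; nia.
Qed.

(** The worth of one level. Entering a child from cell k costs [hk], the value of [hz] there. The
    surplus over [hk] must exceed about 29 r k to outweigh the negative [dz] at k, and stay below
    about 97 r k so that returning from the middle to the parent is outweighed by [dz 0]; 60 lies in
    between. *)
Definition slope : R := 60 * r * IZR k + IZR hk.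
Definition lyap (y : vertex) : R := slope * INR (size y.1.1) + IZR (hz y.1.2).
Definition lyapW (u : seq bool) (i : Z) : R :=
  slope * INR (size u) + IZR (hz i) + r / 2 * IZR (dz i).

Lemma lyapW_cons s u i :
  lyapW (s :: u) i = slope * (INR (size u) + 1) + IZR (hz i) + r / 2 * IZR (dz i).
Proof. by rewrite -S_INR. Qed.

Lemma W_lyap u i b : PA act (PB act r (PA act lyap)) (u, i, b) = lyapW u i.
Proof.
rewrite /lyapW /dz minus_IZR mult_IZR plus_IZR.
by case: b; rewrite /PA /PB /lyap /=; do 2 (case: Z.eqb_spec => ? /=); field.
Qed.

Lemma lyap_drift y : valid_cell y -> lyap y + r <= PA act (PE act (PA act (PB act r (PA act lyap)))) y.
Proof.
case: y => [[u i] b]; rewrite /valid_cell /cell_ok /= => hi.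
(* A jump needs the half [false] and a positive coin for [Ep], two fair events; hence the weight
   1/4. *)
have -> : PA act (PE act (PA act (PB act r (PA act lyap)))) (u, i, b) =
    3 / 4 * lyapW u i + / 4 * (let: (u', i') := jump k xpredT (u, i) in lyapW u' i').
  rewrite {1}/PA /PE /act /=; case: b => /=; case: (jump _ _ _) => u' i' /=;
  by rewrite -/act !W_lyap; field.
have k1 : 1 <= IZR k by apply: IZR_le; lia.
have hrk : r <= r * IZR k by rewrite -{1}(Rmult_1_r r); apply: Rmult_le_compat_l; lra.
have d0 : IZR (dz 0) = 80 * IZR k by rewrite dz_0 mult_IZR.
have dk j : Z.abs j = k -> IZR (dz j) = - (46 * IZR k) + 2.
  by move=> h; rewrite dz_k // plus_IZR opp_IZR mult_IZR.
have h0 : hz 0 = 0%Z by rewrite /hz; case: Z.leb_spec => [_|?]; [rewrite /=; lia | lia].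
have hkE j : Z.abs j = k -> hz j = hk by move=> h; rewrite /hz /hk h Z.leb_refl.
have hopp : Z.abs (- k) = k by lia.
have habs : Z.abs k = k by lia.
rewrite /jump; case: (Z.eqb_spec i 0) => [->|hi0].
  case: u => [|s u].
    rewrite /lyapW d0 /lyap /=; lra.
  have hs : Z.abs (if s then k else (- k)%Z) = k by case: s.
  have -> : lyap (s :: u, 0%Z, b) = slope * (INR (size u) + 1) + IZR (hz 0) by rewrite -S_INR.
  rewrite /lyapW d0 (dk _ hs) (hkE _ hs) h0 -[size (s :: u)]/((size u).+1) S_INR /slope; lra.
case: (Z.eqb_spec i k) => [->|hik].
  by rewrite /= lyapW_cons /lyapW d0 (dk _ habs) /lyap h0 /= (hkE _ habs) /slope; lra.
case: (Z.eqb_spec i (- k)) => [->|hik'].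
  by rewrite /= lyapW_cons /lyapW d0 (dk _ hopp) /lyap h0 /= (hkE _ hopp) /slope; lra.
have hd : 2 <= IZR (dz i) by apply: IZR_le; apply: dz_other => //; lia.
rewrite /lyapW /lyap /=; nra.
Qed.

(** The drift of [lyap] is computed for a cyclic rearrangement of the step. This function transfers
    it to [PT], using that [PE] is idempotent and that [PA] fixes [lyap]. *)
Definition lyapG := PE act (PA act (PB act r (PA act lyap))).

Lemma PA_lyap : PA act lyap = lyap.
Proof.
by apply: functional_extensionality => -[[u i] b]; rewrite /PA /lyap /=; field.
Qed.

Lemma PE_idem f y : valid_cell y -> PE act (PE act f) y = PE act f y.
Proof. by move=> hy; rewrite /PE /act ymvK //; field. Qed.

Lemma lyapG_drift y : valid_cell y -> lyapG y + r <= PT act r lyapG y.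
Proof.
have r01' : 0 <= r <= 1 by lra.
have h1 : lef valid_cell (fun z => lyap z + r) (PA act (PE act lyapG)).
  move=> z hz; apply: (Rle_trans _ _ _ (lyap_drift hz)).
  apply: (PA_le valid_act) (z) hz => z' hz'; rewrite /lyapG PE_idem //; lra.
have h2 := PE_le valid_act (PA_le valid_act (PB_le r01' valid_act h1)).
move=> hy; apply: (Rle_trans _ _ _ _ (h2 _ hy)).
by right; rewrite /lyapG PA_lyap /PE /PA /PB; field.
Qed.

(** The one [Ep] contained in [lyapG] can add a level, which accounts for the additional [slope]. *)
Lemma lyapG_le y : valid_cell y -> lyapG y <= slope * INR (size y.1.1) + (slope + 42 * IZR k * IZR k).
Proof.
have r01' : 0 <= r <= 1 by lra.
have k1 : 1 <= IZR k by apply: IZR_le; lia.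
have hk0 : 0 <= IZR hk by apply: IZR_le; rewrite /hk; nia.
have s0 : 0 <= slope by rewrite /slope; nra.
have h1 : lef valid_cell lyap (fun y => slope * INR (size y.1.1) + 42 * IZR k * IZR k).
  move=> z hz; rewrite /lyap -!mult_IZR; apply: Rplus_le_compat_l; apply: IZR_le; exact: hz_le.
have h2 := PE_le valid_act (PA_le valid_act (PB_le r01' valid_act (PA_le valid_act h1))).
move=> hy; apply: (Rle_trans _ _ _ (h2 _ hy)).
have hsize : (size (jump k xpredT y.1).1 <= (size y.1.1).+1)%N by apply: depth_jump.
have : INR (size (jump k xpredT y.1).1) <= INR (size y.1.1) + 1.
  by rewrite -S_INR; apply: le_INR; apply/leP.
case: y {hy} hsize => [[u i] b] /= _ h.
have hB (f : R) v j c : PA act (PB act r (PA act (fun y => slope * INR (size y.1.1) + f))) (v, j, c) =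
    slope * INR (size v) + f.
  by rewrite /PA /PB /=; case: c => /=; do 2 (case: Z.eqb_spec => ? /=); field.
rewrite {1}/PE hB /act /=.
case: b.
  by rewrite /= -/act hB; lra.
move: h; case: (jump _ _ _) => u' i' /= h.
rewrite -/act hB.
have : slope * INR (size u') <= slope * (INR (size u) + 1) by apply: Rmult_le_compat_l.
lra.
Qed.

Lemma slope_gt0 : 0 < slope.
Proof.
have k1 : 1 <= IZR k by apply: IZR_le; lia.
have hk0 : 0 <= IZR hk by apply: IZR_le; rewrite /hk; nia.
rewrite /slope; have : 0 < r * IZR k by apply: Rmult_lt_0_compat; lra.
lra.
Qed.

Lemma depth_drift : exists C, forall n,
  r * INR n - C <= slope * iter n (PT act r) (fun y => INR (size y.1.1)) root.
Proof.
have r01' : 0 <= r <= 1 by lra.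
exists (slope + 42 * IZR k * IZR k - lyapG root) => n.
have hG : lef valid_cell (fun y => lyapG y + INR n * r) (iter n (PT act r) lyapG).
  elim: n => [|n IH] y hy; first by rewrite /=; lra.
  rewrite iterS; apply: (Rle_trans _ _ _ _ (PT_le r01' valid_act IH hy)).
  by rewrite PT_add S_INR; have := lyapG_drift hy; lra.
have hD : lef valid_cell (iter n (PT act r) lyapG)
    (fun y => slope * iter n (PT act r) (fun y => INR (size y.1.1)) y + (slope + 42 * IZR k * IZR k)).
  elim: n {hG} => [|n IH] y hy; first exact: lyapG_le.
  rewrite !iterS; apply: (Rle_trans _ _ _ (PT_le r01' valid_act IH hy)).
  by rewrite PT_add PT_scal; lra.
have hroot : valid_cell root by rewrite /valid_cell /cell_ok /=; lia.
have := hG _ hroot; have := hD _ hroot; lra.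
Qed.

End Drift.

Local Close Scope R_scope.

(** * The lifted steps *)

Local Open Scope R_scope.

Lemma avg_bool (g : bool -> R) : avg g = (g true + g false) / 2.
Proof.
rewrite avgE card_bool (bigD1 true) //= (bigD1 false) //= big1; last by case.
by field.
Qed.

Lemma avg_point (T : finType) (t0 : T) (a b : R) :
  avg (fun t => if t == t0 then a else b) = (1 - / INR #|T|) * b + / INR #|T| * a.
Proof.
have T0 : (0 < #|T|)%N by apply/card_gt0P; exists t0.
have hT := card_INR_gt0 T0.
transitivity (avg (fun t => b + (a - b) * (if t == t0 then 1 else 0))).
  by apply: avg_ext => t; case: eqP => _; ring.
rewrite avg_add avg_const // avg_scal avgE (bigD1 t0) //= eqxx big1; first by field; apply: Rgt_not_eq; exact: hT.
by move=> t /negbTE ->.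
Qed.

Lemma avg_odd n (s0 : {perm 'I_n}) (a b : R) : odd_perm s0 ->
  avg (fun s : {perm 'I_n} => if odd_perm s then a else b) = (b + a) / 2.
Proof.
move=> h0; pose f (s : {perm 'I_n}) := if odd_perm s then a else b.
have h : avg f + avg (fun s => f (s0 * s)%g) = b + a.
  rewrite -avg_add -[RHS](avg_const (group_card_gt0 {perm 'I_n})); apply: avg_ext => s.
  have -> : f (s0 * s)%g = if odd_perm s then b else a by rewrite /f odd_permM h0; case: (odd_perm s).
  by rewrite /f; case: (odd_perm s); lra.
by move: h; rewrite (avg_inj f (mulgI s0)) -/f; lra.
Qed.

Section Lift.
Variables (d : nat -> nat) (F K : finGroupType).
Variable rho : K -> forall j, 'I_(d j) -> {perm 'I_(d j.+1)}.
Hypothesis sat : saturated rho.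
Hypothesis rho_inj : forall k1 k2 : K,
  (forall j (t : 'I_(d j)), val t <> 0%N -> rho k1 t = rho k2 t) -> k1 = k2.

Local Notation weval := (@weval d F K rho).
Local Notation genval := (@genval d F K rho).
Local Notation G := (gen d F K).
Local Notation Gr := (GRoot F K).
Local Notation Gh := (@GHF d F K).
Local Notation linv := (@letinv d F K).

Definition s0 : {perm 'I_(d 0)} :=
  tperm (Ordinal (ltnW (sat_ge2 sat 0))) (Ordinal (sat_ge2 sat 0)).

Lemma odd_s0 : odd_perm s0.
Proof. by rewrite odd_tperm. Qed.

Lemma s0_neq1 : s0 != 1%g.
Proof. by apply/eqP => h; have := odd_s0; rewrite h odd_perm1. Qed.

Lemma s0V : (s0^-1 = s0)%g.
Proof. exact: tpermV. Qed.

(** By saturation [#|K|] is a multiple of the order of a symmetric group on at least two points, so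
    Cauchy's theorem applies. *)
Lemma involution_ex : exists k : K, k != 1%g /\ (k^-1 = k)%g.
Proof.
have h : (2 %| #|[set: K]|)%N.
  rewrite cardsT -(sat_unif sat (t := Ordinal (sat_ge2 sat 0)) _ 1%g) //.
  apply: dvdn_mull; have -> : #|{: {perm 'I_(d 1)}}| = (d 1)`!.
    by rewrite -[in RHS](card_ord (d 1)) -cardsT -card_Sn cardsT card_ord.
  by apply: dvdn_fact; rewrite /= (sat_ge2 sat).
have [k _ hk] := Cauchy (isT : prime 2) h.
exists k; split; first by rewrite -order_gt1 hk.
by apply/eqP; rewrite eq_invg_mul; have := expg_order k; rewrite hk expgS expg1 => ->.
Qed.

Definition k0 : K := proj1_sig (constructive_indefinite_description _ involution_ex).

Lemma k0_neq1 : k0 != 1%g.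
Proof. by rewrite /k0; case: constructive_indefinite_description => k []. Qed.

Lemma k0V : (k0^-1 = k0)%g.
Proof. by rewrite /k0; case: constructive_indefinite_description => k []. Qed.

(** Both names of the identity, rooted and directed, go to [Ep]: letters with the same value in
    Gamma have to coincide in Delta. *)
Definition lm (a : G) : lamp :=
  match a with
  | GRoot s => if s == 1%g then Ep else if s == s0 then Al else Neutral
  | GHF k f => if (k, f) == (1%g, 1%g) then Ep else if (k, f) == (k0, 1%g) then Be else Neutral
  end.

Definition lift (a : lamp) : G :=
  match a with Al => Gr s0 | Be => Gh k0 1%g | _ => Gr 1%g end.

Lemma lm_inv a : lm (linv a) = lm a.
Proof.
case: a => [s|k f] /=; first by rewrite invg_eq1 -{1}s0V (eqtype.inj_eq invg_inj).
by rewrite !xpair_eqE !invg_eq1 -{1}k0V (eqtype.inj_eq invg_inj).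
Qed.

Lemma lm_lift a : a <> Neutral -> lm (lift a) = a.
Proof.
case: a => //= _.
- by rewrite (negbTE s0_neq1) eqxx.
- by rewrite xpair_eqE (negbTE k0_neq1) /= eqxx.
- by rewrite eqxx.
Qed.

Lemma lm_genval a b : genval a = genval b -> lm a = lm b.
Proof.
have hd := sat_ge2 sat; have hh := sat_hom sat.
case: a b => [s|k f] [s'|k' f'].
- by move=> /(genval_root_inj hd) ->.
- by case/(genval_root_HF hh hd rho_inj) => -> -> ->; rewrite /= !eqxx.
- by move/esym; case/(genval_root_HF hh hd rho_inj) => -> -> ->; rewrite /= !eqxx.
- by case/(genval_HF_inj hd rho_inj) => -> ->.
Qed.

Definition Om : finType := (step d F K * (bool * bool))%type.

Definition wE (c : bool) : seq G := if c then [:: Gr 1%g] else [::].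
(** The identity is spelled by the empty word, since as a letter it would act as [Ep]; the same
    holds in [wK]. *)
Definition wR (s : {perm 'I_(d 0)}) : seq G := if s == 1%g then [::] else [:: Gr s].
Definition wS s := if odd_perm s then Gr s0 :: wR (s0 * s)%g else wR s.
(** The mirror image of [wS]: inverting a step exchanges the two spellings, which makes the lifted
    law symmetric. *)
Definition wS' s := if odd_perm s then wR (s * s0)%g ++ [:: Gr s0] else wR s.
Definition wK (x : K * F) : seq G := if x == (1%g, 1%g) then [::] else [:: Gh x.1 x.2].

(* A lift of the step s k s': the odd permutations are routed through s0, so that the letters of
   type [Al] form independent fair coins, and Gamma-trivial letters [Ep] are inserted at random. *)
Definition sw (om : Om) : seq G :=
  wE om.2.1 ++ wS om.1.1.1 ++ wK om.1.1.2 ++ wS' om.1.2 ++ wE om.2.2.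

Lemma Om_gt0 : (0 < #|Om|)%N.
Proof. by apply/card_gt0P; exists ((1%g, (1%g, 1%g), 1%g), (true, true)). Qed.

Lemma size_wE c : (size (wE c) <= 1)%N. Proof. by case: c. Qed.

Lemma size_wR s : (size (wR s) <= 1)%N. Proof. by rewrite /wR; case: ifP. Qed.

Lemma size_sw om : (size (sw om) <= 7)%N.
Proof.
have hS s : (size (wS s) <= 2)%N.
  by rewrite /wS; case: odd_perm; [exact: size_wR | exact: leq_trans (size_wR _) _].
have hS' s : (size (wS' s) <= 2)%N.
  rewrite /wS'; case: odd_perm; last exact: leq_trans (size_wR _) _.
  by rewrite size_cat /= addn1; exact: size_wR.
have hK x : (size (wK x) <= 1)%N by rewrite /wK; case: ifP.
rewrite /sw !size_cat.
have := size_wE om.2.1; have := size_wE om.2.2; have := hS om.1.1.1; have := hS' om.1.2.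
by have := hK om.1.1.2; lia.
Qed.

Lemma weval_wE c : weval (wE c) = wone d F.
Proof. by case: c; rewrite // /wE weval1 genval_root1. Qed.

Lemma weval_wR s : weval (wR s) = genval (Gr s).
Proof. by rewrite /wR; case: eqP => [->|_]; rewrite ?weval1 ?genval_root1. Qed.

Lemma weval_wS s : weval (wS s) = genval (Gr s).
Proof.
rewrite /wS; case: odd_perm; rewrite ?weval_wR // -cat1s weval_cat weval1 weval_wR genval_rootM.
by rewrite mulgA -{1}s0V mulVg mul1g.
Qed.

Lemma weval_wS' s : weval (wS' s) = genval (Gr s).
Proof.
rewrite /wS'; case: odd_perm; rewrite ?weval_wR // weval_cat weval1 weval_wR genval_rootM.
by rewrite -mulgA -{1}s0V mulVg mulg1.
Qed.

Lemma weval_wK x : weval (wK x) = genval (Gh x.1 x.2).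
Proof.
by rewrite /wK; case: eqP => [->|_]; rewrite ?weval1 // (genval_HF1 F (sat_hom sat)).
Qed.

Lemma weval_sw om : weval (sw om) = weval (stepw om.1).
Proof.
rewrite /sw !weval_cat !weval_wE weval_wS weval_wK weval_wS' wmul1 wmulr1.
by rewrite /stepw /= wmulr1.
Qed.

Definition flip (om : Om) : Om :=
  ((om.1.2^-1, (om.1.1.2.1^-1, om.1.1.2.2^-1), om.1.1.1^-1)%g, (om.2.2, om.2.1)).

Lemma flip_bij : bijective flip.
Proof. by exists flip => -[[[s [k f]] s'] [c c']]; rewrite /flip /= !invgK. Qed.

Lemma sw_flip om : sw (flip om) = winv linv (sw om).
Proof.
have hE c : winv linv (wE c) = wE c by case: c => //=; rewrite /winv /= invg1.
have hR s : winv linv (wR s) = wR s^-1%g by rewrite /wR invg_eq1; case: ifP.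
have hS s : winv linv (wS s) = wS' s^-1%g.
  rewrite /wS /wS' odd_permV; case: (odd_perm s); last exact: hR.
  by rewrite winv_cons hR invMg /= !s0V.
have hS' s : winv linv (wS' s) = wS s^-1%g.
  rewrite /wS /wS' odd_permV; case: (odd_perm s); last exact: hR.
  by rewrite winv_cat hR invMg /winv /= !s0V.
have hK x : winv linv (wK x) = wK (x.1^-1, x.2^-1)%g.
  by case: x => k f; rewrite /wK !xpair_eqE !invg_eq1; case: ifP.
by rewrite /sw !winv_cat !hE hS hK hS' -!catA.
Qed.

Section Act.
Variables (X : Type) (act : lamp -> X -> X).
Hypothesis act_neutral : forall x, act Neutral x = x.

Let r : R := / INR #|{: K * F}|.
Let ract w x := run act (map lm w) x.

Lemma ract_wR s x : s != s0 -> ract (wR s) x = x.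
Proof.
rewrite /wR /ract => /negbTE h; case h1: (s == 1%g) => //.
by rewrite /= h1 h act_neutral.
Qed.

Lemma even_neq_s0 s : ~~ odd_perm s -> s != s0.
Proof. by apply: contraNneq => ->; rewrite odd_s0. Qed.

Lemma lm_s0 : lm (Gr s0) = Al.
Proof. by rewrite /= (negbTE s0_neq1) eqxx. Qed.

Lemma ract_wS s x : ract (wS s) x = if odd_perm s then act Al x else x.
Proof.
rewrite /wS; case h: (odd_perm s); last by apply: ract_wR; apply: even_neq_s0; rewrite h.
rewrite -cat1s /ract map_cat run_cat -/(ract _ _) ract_wR; last first.
  by apply: even_neq_s0; rewrite odd_permM odd_s0 h.
by rewrite -lm_s0.
Qed.

Lemma ract_wS' s x : ract (wS' s) x = if odd_perm s then act Al x else x.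
Proof.
rewrite /wS'; case h: (odd_perm s); last by apply: ract_wR; apply: even_neq_s0; rewrite h.
rewrite /ract map_cat run_cat -/(ract (wR _) x) ract_wR; last first.
  by apply: even_neq_s0; rewrite odd_permM odd_s0 h.
by rewrite -lm_s0.
Qed.

Lemma ract_wK y x : ract (wK y) x = if y == (k0, 1%g) then act Be x else x.
Proof.
rewrite /wK /ract; case: eqP => [->|/eqP/negbTE h].
  by rewrite xpair_eqE eq_sym (negbTE k0_neq1).
case: y h => k f /= h; rewrite h; case: ifP => //; by rewrite act_neutral.
Qed.

Lemma ract_wE c x : ract (wE c) x = if c then act Ep x else x.
Proof. by case: c; rewrite // /ract /= eqxx. Qed.

Lemma PAE f x : PA act f x = (f x + f (act Al x)) / 2.
Proof. by []. Qed.

(** The parity of a uniform permutation is a fair coin, the letter of type [Be] is drawn with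
    probability [r], and the remaining letters are neutral. Even permutations never equal [s0], so
    no further [Al] occurs. *)
Lemma avg_step phi x : avg (fun om => phi (ract (sw om) x)) = PT act r phi x.
Proof.
have hrun om : ract (sw om) x = ract (wE om.2.2) (ract (wS' om.1.2) (ract (wK om.1.1.2)
    (ract (wS om.1.1.1) (ract (wE om.2.1) x)))) by rewrite /ract /sw !map_cat !run_cat.
rewrite (avg_ext (fun om => congr1 phi (hrun om))) avg_pair avg_swap avg_pair.
rewrite avg_bool /PT; rewrite {1}/PE Rplus_comm.
have hc y : avg (fun c' => avg (fun st : step d F K => phi (ract (wE c')
    (ract (wS' st.2) (ract (wK st.1.2) (ract (wS st.1.1) y)))))) =
    PA act (PB act r (PA act (PE act phi))) y.
  rewrite avg_swap.
  have hE z : avg (fun c' => phi (ract (wE c') z)) = PE act phi z.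
    by rewrite avg_bool !ract_wE /PE Rplus_comm.
  rewrite (avg_ext (fun st => hE _)) avg_pair /=.
  have hS' z : avg (fun s' => PE act phi (ract (wS' s') z)) = PA act (PE act phi) z.
    rewrite [RHS]PAE -(avg_odd _ _ odd_s0); apply: avg_ext => s'.
    by rewrite ract_wS'; case: (odd_perm s').
  rewrite (avg_ext (fun st => hS' _)) avg_pair /=.
  have hK z : avg (fun y => PA act (PE act phi) (ract (wK y) z)) = PB act r (PA act (PE act phi)) z.
    rewrite /PB -(avg_point (k0, 1%g)); apply: avg_ext => t.
    by rewrite ract_wK; case: eqP.
  rewrite (avg_ext (fun s => hK _)) /= [RHS]PAE -(avg_odd _ _ odd_s0); apply: avg_ext => s.
  by rewrite ract_wS; case: (odd_perm s).
by congr ((_ + _) / _); rewrite hc /= ?eqxx.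
Qed.

Lemma EW_run n phi x : EW sw n (fun w => phi (ract w x)) = iter n (PT act r) phi x.
Proof.
elim: n x => [//|n IH] x; rewrite iterS -avg_step /=; apply: avg_ext => om.
rewrite -IH; apply: EW_ext => w.
by rewrite /ract map_cat run_cat.
Qed.

End Act.

(** Whatever the coins, a lifted step has the same value in Gamma as the original one. *)
Lemma EW_lift n (f : seq G -> R) : (forall w v, weval w = weval v -> f w = f v) ->
  EW sw n f = EW (@stepw d F K) n f.
Proof.
elim: n f => [//|n IH] f hf /=.
transitivity (avg (fun st : step d F K => avg (fun cc : bool * bool =>
  EW sw n (fun w => f (sw (st, cc) ++ w))))); first exact: avg_pair.
apply: avg_ext => st.
rewrite -[RHS](avg_const (T := {: bool * bool})); last by rewrite card_prod card_bool.
apply: avg_ext => cc; rewrite IH; last by move=> w v h; apply: hf; rewrite !weval_cat h.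
by apply: EW_ext => w; apply: hf; rewrite (weval_cat _ (sw _)) weval_sw -weval_cat.
Qed.

End Lift.

Local Close Scope R_scope.

(** * Oscillation *)

Local Open Scope R_scope.

(** Once [z] is right modulo [E], the remaining defect is trivial modulo [E] and falls into one of
    finitely many classes for [G]; one stored word per class repairs it. *)
Lemma finite_extension A (inv : A -> A) E G (Q : finType) (q : seq A -> Q) (B : seq A -> nat) :
  congruence inv E -> congruence inv G -> (forall w v, q w = q v -> G w v) ->
  (forall w, exists z, E z w /\ (size z <= B w)%N) ->
  exists C, forall w, exists z, (E z w /\ G z w) /\ (size z <= B w + C)%N.
Proof.
move=> cE cG hq hB.
have [C hC] := bounded_choice (fun i w => E w [::] /\ val (enum_rank (q w)) = i) #|Q|.
exists C => w; have [z [Ez sz]] := hB w.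
have Eu : E (winv inv z ++ w) [::].
  apply: (cong_trans cE _ (cong_winvl cE z)); apply: (cong_catr cE); exact: (cong_sym cE).
have [|v [[Ev qv] sv]] := hC _ (ltn_ord (enum_rank (q (winv inv z ++ w)))).
  by exists (winv inv z ++ w).
have Gv : G v (winv inv z ++ w) by apply: hq; apply: enum_rank_inj; apply: val_inj.
exists (z ++ v); split; last by rewrite size_cat leq_add.
split.
  by apply: (cong_trans cE _ Ez); have := cong_catr cE z Ev; rewrite cats0.
apply: (cong_trans cG (cong_catr cG z Gv)); rewrite catA -[X in G _ X]cat0s.
exact: (cong_catl cG w (cong_winvr cG z)).
Qed.

(** * Successive choice of the finite factors and of the slow and fast times *)

Section Stages.
Variables (d : nat -> nat) (F K : finGroupType).
Variable rho : K -> forall j, 'I_(d j) -> {perm 'I_(d j.+1)}.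
Hypothesis sat : saturated rho.

Local Notation G := (gen d F K).
Local Notation linv := (@letinv d F K).
Local Notation lm := (@lm d F K rho sat).
Local Notation lmw := (map lm).
Local Notation sw := (@sw d F K rho sat).
Local Notation eqG := (@eqG d F K rho).
Local Notation LG := (@LG d F K rho).

Definition E0 (w v : seq G) : Prop := eqG w v /\ eqL (lmw w) (lmw v).

Lemma congruence_eqG : congruence linv eqG.
Proof. exact: (congruence_weval F (sat_hom sat)). Qed.

Lemma congruence_E0 : congruence linv E0.
Proof. exact: (congruence_base congruence_eqG (lm_inv sat)). Qed.

Definition eqTm (x : Z * nat) (w v : seq G) : Prop := eqT x.1 x.2 (lmw w) (lmw v).

Lemma congruence_eqTm x : (0 < x.1)%Z -> congruence linv (eqTm x).
Proof. by move=> h; apply: (congruence_map (congruence_eqT _ h) (lm_inv sat)). Qed.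

Fixpoint stageE (l : seq (Z * nat)) (w v : seq G) : Prop :=
  if l is x :: l' then stageE l' w v /\ eqTm x w v else E0 w v.

Fixpoint positive (l : seq (Z * nat)) : Prop :=
  if l is x :: l' then positive l' /\ (0 < x.1)%Z else True.

Lemma congruence_stage l : positive l -> congruence linv (stageE l).
Proof.
elim: l => [_|x l IH] /=; first exact: congruence_E0.
by case=> /IH h1 h2; apply: congruence_and => //; apply: congruence_eqTm.
Qed.

Definition travel (w : seq G) : nat := Z.to_nat (far base (lmw w)).

Lemma stage_short l : positive l -> exists C, forall w, exists z, stageE l z w /\
  (size z <= C * (nrm eqG w + travel w + 1))%N.
Proof.
elim: l => [_|x l IH] /=.
  have hep : eqG [:: lift F sat Ep] [::] by rewrite /eqG weval1; apply: genval_root1.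
  have ha : linv (lift F sat Al) = lift F sat Al by rewrite /= s0V.
  have hb : linv (lift F sat Be) = lift F sat Be by rewrite /= k0V invg1.
  exact: (short_word congruence_eqG (lm_inv sat) (fun a => @lm_lift d F K rho sat a) hep ha hb).
case=> pl px; have [C hC] := IH pl.
have [Q [q hq]] := eqT_finite x.2 px.
have [C' hC'] := finite_extension (congruence_stage pl) (congruence_eqTm px)
  (q := fun w => q (lmw w)) (fun w v => hq (lmw w) (lmw v)) hC.
exists (C + C')%N => w; have [z [h1 h2]] := hC' w; exists z; split=> //; nia.
Qed.

Let r : R := / INR #|{: K * F}|.

Lemma r_bounds : 0 < r <= 1.
Proof.
have h : (0 < #|{: K * F}|)%N by apply/card_gt0P; exists (1%g, 1%g).
have h1 : 1 <= INR #|{: K * F}| by rewrite -[1]/(INR 1); apply: le_INR; apply/leP.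
split; first by apply: Rinv_0_lt_compat; lra.
by rewrite -Rinv_1 /r; apply: Rinv_le_contravar; lra.
Qed.

(** Integrate [x <= x^2 / (2 sqrt n) + sqrt n / 2] and use the bound [4 n] on the second moment of
    the range. *)
Lemma travel_diffusive n : (0 < n)%N -> EW sw n (fun w => INR (travel w)) <= 3 * sqrt (INR n).
Proof.
move=> n0; have hn : 0 < INR n by apply: lt_0_INR; apply/ltP.
have sn := sqrt_lt_R0 _ hn; have ss := sqrt_sqrt _ (Rlt_le _ _ hn).
have r01 : 0 <= r <= 1 by have := r_bounds; lra.
pose phi (y : site * Z) := IZR y.2 * IZR y.2.
have h1 : EW sw n (fun w => phi (run mvmax (lmw w) (base, 0%Z))) <= 4 * INR n.
  by rewrite (EW_run F sat (act := mvmax)) //; [exact: (PT_iter_max_base r01) | case].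
have h2 : EW sw n (fun w => INR (travel w)) <=
    EW sw n (fun w => / (2 * sqrt (INR n)) * phi (run mvmax (lmw w) (base, 0%Z)) + sqrt (INR n) / 2).
  apply: (EW_le (Om_gt0 d F K) (size_sw sat)) => w _.
  have hf := far_start base (lmw w).
  have -> : INR (travel w) = IZR (far base (lmw w)).
    by rewrite INR_IZR_INZ /travel Z2Nat.id //; rewrite /= in hf; lia.
  rewrite /phi run_mvmax //= Z.max_r; last by rewrite /= in hf; lia.
  set x := IZR _; apply: (Rmult_le_reg_l (2 * sqrt (INR n))); first lra.
  rewrite Rmult_plus_distr_l -Rmult_assoc Rinv_r; last lra.
  have := Rle_0_sqr (x - sqrt (INR n)); rewrite /Rsqr; lra.
apply: (Rle_trans _ _ _ h2).
rewrite EW_add EW_scal (EW_const _ (Om_gt0 d F K)).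
have : / (2 * sqrt (INR n)) * EW sw n (fun w => phi (run mvmax (lmw w) (base, 0%Z))) <=
    / (2 * sqrt (INR n)) * (4 * INR n).
  by apply: Rmult_le_compat_l => //; left; apply: Rinv_0_lt_compat; lra.
have -> : / (2 * sqrt (INR n)) * (4 * INR n) = 2 * sqrt (INR n) by rewrite -{2}ss; field; lra.
lra.
Qed.

Lemma LG_lift n : EW sw n (fun w => INR (nrm eqG w)) = LG n.
Proof.
rewrite EW_lift.
  by rewrite /LG EG_EW; apply: EW_ext => w; rewrite wnormGE.
move=> w v h; congr INR; rewrite /nrm; congr minnat.
apply: functional_extensionality => i; apply: propositional_extensionality.
by rewrite /eqG h.
Qed.

Lemma stage_speed l : positive l -> exists C, 0 < C /\ forall n, (0 < n)%N ->
  EW sw n (fun w => INR (nrm (stageE l) w)) <= C * (LG n + 3 * sqrt (INR n) + 1).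
Proof.
move=> pl; have [C hC] := stage_short pl.
exists (INR C + 1); split; first by have := pos_INR C; lra.
move=> n n0; have hT := travel_diffusive n0.
have h0 : forall w, 0 <= INR (nrm eqG w) + INR (travel w) + 1.
  by move=> w; have := pos_INR (nrm eqG w); have := pos_INR (travel w); lra.
apply: (Rle_trans _ (EW sw n (fun w => (INR C + 1) * (INR (nrm eqG w) + INR (travel w) + 1)))).
  apply: (EW_le (Om_gt0 d F K) (size_sw sat)) => w _.
  have [z [h1 h2]] := hC w.
  have := leq_trans (nrm_le h1) h2; move=> /leP /le_INR.
  rewrite -multE mult_INR -!plusE !plus_INR /=.
  by have := h0 w; lra.
rewrite EW_scal !EW_add (EW_const _ (Om_gt0 d F K)) LG_lift.
by apply: Rmult_le_compat_l; [have := pos_INR C; lra | lra].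
Qed.

Lemma tree_speed k : (0 < k)%Z -> exists c C, 0 < c /\ forall n D, (7 * n <= D)%N ->
  c * INR n - C <= EW sw n (fun w => INR (size (run (tmv k D) (lmw w) root).1.1)).
Proof.
move=> k0; have rb := r_bounds; have s0 := slope_gt0 k0 rb.
have [C hC] := depth_drift k0 rb.
exists (r / slope k r), (C / slope k r); split; first exact: Rdiv_lt_0_compat (proj1 rb) s0.
move=> n D hD.
have -> : EW sw n (fun w => INR (size (run (tmv k D) (lmw w) root).1.1)) =
    iter n (PT (ymv k xpredT) r) (fun y => INR (size y.1.1)) root.
  rewrite -(EW_run F sat (act := ymv k xpredT) _ n (fun y => INR (size y.1.1)) root); last by case=> -[].
  apply: Rle_antisym; apply: (EW_le (Om_gt0 d F K) (size_sw sat)) => w hw;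
    rewrite tmv_run /= ?size_map //; try (by right); exact: leq_trans hw hD.
apply: (Rmult_le_reg_l (slope k r)) => //.
have -> : slope k r * (r / slope k r * INR n - C / slope k r) = r * INR n - C by field; lra.
exact: hC.
Qed.

Variables (L1 L2 : nat -> R).
Hypothesis hL1 : cv_infty (fun n => Rdiv (L1 n) (LG n)).
Hypothesis hL2 : Un_cv (fun n => Rdiv (L2 n) (INR n)) 0.

(** [x] holds kappa and the truncation depth of the new factor, [m] is the fast time and [n] the
    slow one. Two words of total length at most [R0] that agree in the lamplighter must not be
    separated by the new factor. *)
Definition stage_ok (l : seq (Z * nat)) (R0 N : nat) (x : Z * nat) (m n : nat) : Prop :=
  [/\ (4 * Z.of_nat R0 < x.1)%Z, (N <= m)%N, (N <= n)%N,
      L2 m <= EW sw m (fun w => INR (size (run (tmv x.1 x.2) (lmw w) root).1.1)) &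
      EW sw n (fun w => INR (nrm (stageE (x :: l)) w)) <= L1 n].

Lemma stage_ex l R0 N : positive l -> exists x m n, stage_ok l R0 N x m n.
Proof.
move=> pl; pose k := (4 * Z.of_nat R0 + 1)%Z.
have k0 : (0 < k)%Z by lia.
have [c [C [c0 hc]]] := tree_speed k0.
have ch : c / 2 > 0 by lra.
have [m1 hm1] := hL2 ch.
have [m2 hm2] := archimed (2 * C / c).
pose m := (maxn (maxn N m1) (Z.to_nat (up (2 * C / c)))).+1.
have m0 : 0 < INR m by apply: lt_0_INR; apply/ltP.
have hm : L2 m <= c * INR m - C.
  have h1 : L2 m <= c / 2 * INR m.
    have hge : (m >= m1)%coq_nat by apply/leP; rewrite /m; lia.
    have := hm1 m hge; rewrite /R_dist Rminus_0_r => /Rabs_def2 [h _].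
    have := Rmult_lt_compat_r _ _ _ m0 h; rewrite /Rdiv Rmult_assoc Rinv_l; lra.
  have h2 : 2 * C / c <= INR m.
    have : IZR (up (2 * C / c)) <= INR m by rewrite INR_IZR_INZ; apply: IZR_le; rewrite /m; lia.
    lra.
  have : c * (2 * C / c) <= c * INR m by apply: Rmult_le_compat_l; lra.
  have -> : c * (2 * C / c) = 2 * C by field; lra.
  lra.
(* A lifted step has at most 7 letters, so the walk does not notice the truncation up to time
   [m]. *)
pose x := (k, (7 * m)%N).
have px : positive (x :: l) by [].
have [C1 [C10 hC1]] := stage_speed px.
have [c2 [c20 hc2]] := LG_diffusive F sat.
(* At a diffusive time, [3 sqrt n + 1 <= 4 sqrt n <= (4 / c2) * LG n]. *)
have [n1 hn1] := hL1 (C1 * (1 + 4 / c2)).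
have [n [hn [n0 hs]]] := hc2 (maxn N n1).
exists x, m, n; split.
- by rewrite /x /k /=; lia.
- by rewrite /m; lia.
- by move: hn; rewrite geq_max => /andP[].
- by apply: (Rle_trans _ _ _ hm); apply: hc.
- apply: (Rle_trans _ _ _ (hC1 _ n0)).
  have n11 : 1 <= INR n by rewrite -[1]/(INR 1); apply: le_INR; apply/leP.
  have s1 : 1 <= sqrt (INR n) by rewrite -sqrt_1; apply: sqrt_le_1; lra.
  have LGp : 0 < LG n by have := Rmult_lt_0_compat _ _ c20 (Rlt_le_trans _ _ _ Rlt_0_1 s1); lra.
  have hge : (n1 <= n)%coq_nat by apply/leP; move: hn; rewrite geq_max => /andP[].
  have := Rmult_lt_compat_r _ _ _ LGp (hn1 n hge).
  rewrite /Rdiv (Rmult_assoc (L1 n)) Rinv_l; last lra.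
  rewrite Rmult_1_r => h; left; apply: Rle_lt_trans h.
  rewrite Rmult_assoc; apply: Rmult_le_compat_l; first lra.
  have : sqrt (INR n) <= / c2 * LG n.
    by apply: (Rmult_le_reg_l c2) => //; rewrite -Rmult_assoc Rinv_r; lra.
  lra.
Qed.

Definition stage := (seq (Z * nat) * nat)%type.

(** Positivity is a premise inside the specification, with a default value otherwise, so that
    [stages] can be defined before positivity is proved along it. *)
Lemma choose_next (st : stage) (N : nat) :
  {y : (Z * nat) * (nat * nat) | positive st.1 -> stage_ok st.1 st.2 N y.1 y.2.1 y.2.2}.
Proof.
apply: constructive_indefinite_description.
have [p|p] := classic (positive st.1); last by exists ((0%Z, 0%N), (0%N, 0%N)).
have [x [m [n h]]] := stage_ex st.2 N p.
by exists (x, (m, n)).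
Qed.

(** The factor 14 is twice 7: at the slow time a word of the walk is compared with a representative
    that is no longer. *)
Fixpoint stages (i : nat) : stage :=
  if i is i'.+1 then
    let st := stages i' in let y := proj1_sig (choose_next st i') in
    (y.1 :: st.1, maxn st.2 (14 * y.2.2))
  else ([::], 0%N).

Definition choice i := proj1_sig (choose_next (stages i) i).

Lemma stages_ok i : positive (stages i).1 /\
  stage_ok (stages i).1 (stages i).2 i (choice i).1 (choice i).2.1 (choice i).2.2.
Proof.
have hp : positive (stages i).1.
  elim: i => [//|i IH] /=; split=> //.
  by case: (proj2_sig (choose_next (stages i) i) IH) => h _ _ _ _; lia.
by split=> //; apply: (proj2_sig (choose_next (stages i) i)).
Qed.

Lemma stages_mono i j : (i <= j)%N -> ((stages i).2 <= (stages j).2)%N.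
Proof.
elim: j => [|j IH]; first by rewrite leqn0 => /eqP ->.
rewrite leq_eqVlt => /orP[/eqP -> //|]; rewrite ltnS => /IH h.
by apply: (leq_trans h); rewrite /= leq_maxl.
Qed.

Lemma stageE_choice i j w v : (j < i)%N -> stageE (stages i).1 w v -> eqTm (choice j).1 w v.
Proof.
elim: i => [//|i IH]; rewrite ltnS leq_eqVlt => /orP[/eqP -> [] //|h [h1 _]]; exact: IH.
Qed.

Lemma stageE_E0 l w v : stageE l w v -> E0 w v.
Proof. by elim: l => [//|x l IH] [/IH]. Qed.

Definition Einf (w v : seq G) : Prop := E0 w v /\ forall i, eqTm (choice i).1 w v.

Lemma choice_gt0 i : (0 < (choice i).1.1)%Z.
Proof. by have [_ [h _ _ _ _]] := stages_ok i; lia. Qed.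

Lemma congruence_Einf : congruence linv Einf.
Proof.
apply: congruence_and congruence_E0 _; apply: congruence_forall => i.
exact: congruence_eqTm (choice_gt0 i).
Qed.

Lemma Einf_fast i : L2 (choice i).2.1 <= EW sw (choice i).2.1 (fun w => INR (nrm Einf w)).
Proof.
have [_ [_ _ _ h _]] := stages_ok i.
apply: (Rle_trans _ _ _ h); apply: (EW_le (Om_gt0 d F K) (size_sw sat)) => w _.
have [v [<- [_ hv]]] := nrm_ex (cong_refl congruence_Einf w).
apply: le_INR; apply/leP; rewrite -(size_map lm).
by apply: (depth_eqT (choice_gt0 i)); apply: (cong_sym (congruence_eqTm (choice_gt0 i))).
Qed.

(** A shortest representative for the factors up to [i] is no longer than the walk's own word.
    Together they are too short for the later factors to separate, so it also represents the word
    modulo [Einf]. *)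
Lemma Einf_slow i : EW sw (choice i).2.2 (fun w => INR (nrm Einf w)) <= L1 (choice i).2.2.
Proof.
have [hp [_ _ _ _ h]] := stages_ok i.
apply: (Rle_trans _ _ _ _ h); apply: (EW_le (Om_gt0 d F K) (size_sw sat)) => w hw.
have hcong : congruence linv (stageE (stages i.+1).1) := congruence_stage (stages_ok i.+1).1.
have [v [sv Ev]] := nrm_ex (cong_refl hcong w).
have hvw : (size v <= size w)%N by rewrite sv; apply: nrm_le; exact: (cong_refl hcong).
apply: le_INR; apply/leP; rewrite -[X in (_ <= X)%N]sv; apply: nrm_le.
split=> [|j]; first exact: stageE_E0 Ev.
have [hj|hj] := ltnP j i.+1; first exact: stageE_choice hj Ev.
have [_ [hk _ _ _ _]] := stages_ok j.
apply: eqT_relation; [exact: choice_gt0 | | exact: (stageE_E0 Ev).2].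
have hR := stages_mono hj.
have hR1 : (14 * (choice i).2.2 <= (stages i.+1).2)%N by rewrite /= leq_maxr.
by rewrite !size_map; lia.
Qed.

End Stages.

Local Close Scope R_scope.

Local Open Scope R_scope.

Theorem mainTheorem15
  (d : nat -> nat) (hd2 : forall j, (2 <= d j)%N) (hdb : exists B, forall j, (d j <= B)%N)
  (K F : finGroupType) (rho : K -> forall j, 'I_(d j) -> {perm 'I_(d j.+1)})
  (rho_hom : forall (k1 k2 : K) j (t : 'I_(d j)), val t <> 0%N ->
      rho (k1 * k2)%g j t = (rho k1 j t * rho k2 j t)%g)
  (rho_inj : forall k1 k2 : K,
      (forall j (t : 'I_(d j)), val t <> 0%N -> rho k1 j t = rho k2 j t) -> k1 = k2)
  (rho_unif : forall j (t : 'I_(d j)), val t <> 0%N -> forall p : {perm 'I_(d j.+1)},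
      (#|[set k : K | rho k j t == p]| * #|{: {perm 'I_(d j.+1)}}| = #|K|)%N)
  (L1 L2 : nat -> R) (hL1pos : forall n, Rlt (INR 0) (L1 n)) (hL2pos : forall n, Rlt (INR 0) (L2 n))
  (hL1 : cv_infty (fun n => Rdiv (L1 n) (@LG d F K rho n)))
  (hL2 : Un_cv (fun n => Rdiv (L2 n) (INR n)) (INR 0)) :
  exists (D : Grp) (iota : gen d F K -> D) (pi : D -> wr d F)
         (supp : list D) (m : D -> R) (C : R),
    (* Sigma' = iota(gen) is a finite symmetric generating set of D *)
    (forall a : D, exists w : list (gen d F K), a = gprod (map iota w)) /\
    (forall g, exists g', iota g' = ginv (iota g)) /\
    (* pi is a homomorphism onto Gamma *)
    (forall a b : D, weq (pi (gmul a b)) (wmul (pi a) (pi b))) /\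
    (forall a : D, exists w, weq (pi a) (@weval d F K rho w)) /\
    (forall w, exists a : D, weq (pi a) (@weval d F K rho w)) /\
    (* pi maps Sigma' bijectively onto Sigma *)
    (forall g, weq (pi (iota g)) (@genval d F K rho g)) /\
    (forall g1 g2, iota g1 = iota g2 <-> weq (@genval d F K rho g1) (@genval d F K rho g2)) /\
    (* mu' : symmetric probability measure with finite support, pi_* mu' = mu *)
    List.NoDup supp /\
    (forall a, Rle (INR 0) (m a)) /\
    (forall a, ~ List.In a supp -> m a = INR 0) /\
    sumR supp m = INR 1 /\
    (forall a, m (ginv a) = m a) /\
    (forall gam : wr d F,
        sumR supp (fun a => if pb (weq (pi a) gam) then m a else INR 0) = @muG d F K rho gam) /\
    (* (1) *)
    (forall n, Rle (@LG d F K rho n) (LD iota supp m n) /\ Rle (LD iota supp m n) (Rmult C (INR n))) /\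
    (* (2) *)
    (forall N, exists n, (N <= n)%N /\ Rle (LD iota supp m n) (L1 n)) /\
    (* (3) *)
    (forall N, exists n, (N <= n)%N /\ Rle (L2 n) (LD iota supp m n)).
Proof.
pose sat := Saturated hd2 rho_hom rho_unif.
pose E := Einf sat hL1 hL2.
have cE : congruence (@letinv d F K) E := congruence_Einf sat hL1 hL2.
pose lift_step := sw (F := F) sat.
have O0 := Om_gt0 d F K.
have hsize := size_sw (F := F) sat.
have EG v w : E v w -> weval rho v = weval rho w by case=> -[].
(* The value in Gamma is read off a representative, which is legitimate because [E] refines equality
   in Gamma; 7 bounds the number of letters of a lifted step. *)
exists (quotGrp cE), (fun a => cls E [:: a]), (fun a => weval rho (rep a)),
  (qsupp E lift_step), (qm (E := E) lift_step), 7.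
split; first by move=> a; exists (rep a); rewrite gprod_cls repK.
split; first by move=> g; exists (letinv g); rewrite /= (qinv_cls cE).
split.
  by move=> a b; apply/weqE; rewrite -weval_cat; apply: EG; apply: (rep_cls cE).
split; first by move=> a; exists (rep a).
split; first by move=> w; exists (cls E w); apply/weqE/EG/(rep_cls cE).
split.
  by move=> g; apply/weqE; rewrite -(weval1 rho); apply/EG/(rep_cls cE).
split.
  move=> g1 g2; rewrite (cls_eq cE); split=> [/EG|/weqE h].
    by rewrite !weval1 => h; apply/weqE.
  (* The lamplighter and all finite factors see a letter only through [lm]. *)
  have hl : map (lm sat) [:: g1] = map (lm sat) [:: g2] by rewrite /= (lm_genval sat rho_inj h).
  split; first split.
  - by rewrite /eqG !weval1.
  - by rewrite hl; apply: (cong_refl congruence_eqL).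
  - by move=> i; rewrite /eqTm hl.
split; first exact: List.NoDup_nodup.
split; first by move=> a; apply: qm_ge0.
split; first exact: qm_notin.
split.
  rewrite sumRE -[RHS](avg_const O0) -(rsum_qm (E := E) lift_step (fun=> 1)).
  by apply: eq_bigr => a _; rewrite Rmult_1_r.
split.
  apply: (qm_inv cE (h := @flip d F K)); first exact: flip_bij.
  by move=> om; rewrite /lift_step sw_flip; apply: (cong_refl cE).
split.
  move=> gam; pose ga (a : quot E) := ind (weq (weval rho (rep a)) gam).
  transitivity (avg (fun om => ga (cls E (lift_step om)))).
    rewrite -(rsum_qm (E := E) lift_step) sumRE; apply: eq_bigr => a _.
    by rewrite /ga /ind; case: pb; rewrite ?Rmult_1_r ?Rmult_0_r.
  transitivity (avg (fun st : step d F K => avg (fun cc : bool * bool => ga (cls E (lift_step (st, cc)))))).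
    exact: avg_pair.
  apply: avg_ext => st; rewrite -[RHS](avg_const (T := {: bool * bool})); last by rewrite card_prod card_bool.
  apply: avg_ext => cc; rewrite /ga /ind.
  by rewrite (EG _ _ (rep_cls cE _)) /lift_step weval_sw.
have hLD n : LD (D := quotGrp cE) (fun a => cls E [:: a]) (qsupp E lift_step) (qm (E := E) lift_step) n =
    EW lift_step n (fun w => INR (nrm E w)) by apply: LD_cls.
split.
  move=> n; rewrite hLD; split.
    rewrite -(LG_lift F sat); apply: (EW_le O0 hsize) => w _; apply: le_INR; apply/leP.
    by apply: (nrm_mono (E := E)); [exact: EG | exact: (cong_refl cE)].
  rewrite -(EW_const lift_step O0 n (7 * INR n)); apply: (EW_le O0 hsize) => w hw.
  have h7 : 7 * INR n = INR (7 * n) by rewrite -multE mult_INR /=; lra.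
  rewrite h7; apply: le_INR; apply/leP; apply: leq_trans hw; apply: nrm_le; exact: (cong_refl cE).
split=> N.
  exists (choice sat hL1 hL2 N).2.2; rewrite hLD; split; last exact: Einf_slow.
  by case: (stages_ok sat hL1 hL2 N) => _ [].
exists (choice sat hL1 hL2 N).2.1; rewrite hLD; split; last exact: Einf_fast.
by case: (stages_ok sat hL1 hL2 N) => _ [].
Qed.
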